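(* Let $a>0$ and $h\in\mathbb{R}$, $h\neq 0$, be constants and let $f\in L^{2}(\mathbb{R})$. Consider the equation $$-\frac{d^{2}u(x)}{dx^{2}}-a\,u(x-h)=f(x),\qquad x\in\mathbb{R}. \qquad ( * )$$ a) If $h\neq \frac{2\pi n}{\sqrt{a}}$ for all $n\in\mathbb{Z}$, then equation $( * )$ admits a unique solution $u\in H^{2}(\mathbb{R})$. b) If $h=\frac{2\pi n}{\sqrt{a}}$ for some $n\in\mathbb{Z}$, $n\neq 0$, assume in addition that $xf(x)\in L^{1}(\mathbb{R})$. Then equation $( * )$ possesses a unique solution $u\in H^{2}(\mathbb{R})$ if and only if the orthogonality conditions $$\left(f(x),\frac{e^{\pm i\sqrt{a}x}}{\sqrt{2\pi}}\right)_{L^{2}(\mathbb{R})}=0$$ hold (for both choices of sign).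
   Context: $H^{2}(\mathbb{R})$ is the Sobolev space with norm $\|u\|_{H^{2}(\mathbb{R})}^{2}=\|u\|_{L^{2}(\mathbb{R})}^{2}+\|u''\|_{L^{2}(\mathbb{R})}^{2}$; the equation is understood as an equality in $L^{2}(\mathbb{R})$ (almost everywhere). The notation $(f_{1},f_{2})_{L^{2}(\mathbb{R})}:=\int_{\mathbb{R}}f_{1}(x)\overline{f_{2}(x)}\,dx$ is used also when $f_{1}\in L^{1}(\mathbb{R})$ and $f_{2}$ is bounded but not square integrable. (If $f\in L^2(\mathbb{R})$ and $xf\in L^1(\mathbb{R})$, then $f\in L^1(\mathbb{R})$, so the integrals in b) make sense.) *)

(* Defs.v *)
From HB Require Import structures.
From mathcomp Require Import all_boot all_order all_algebra.
From mathcomp Require Import complex.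
From mathcomp Require Import all_classical all_reals all_analysis.

Set Implicit Arguments.
Unset Strict Implicit.
Unset Printing Implicit Defensive.

Import Order.TTheory GRing.Theory Num.Theory.
Import numFieldNormedType.Exports.

Local Open Scope classical_set_scope.
Local Open Scope ring_scope.
Local Open Scope complex_scope.

(* Elements of L^p(R; C) are represented by functions R -> R[i], with
   almost-everywhere equality kept explicit instead of passing to a quotient.
   R[i] has no measurable structure in the libraries, hence the
   componentwise measurability. *)
Definition cLp (R : realType) (p : \bar R) (f : R -> R[i]) : Prop :=
  [/\ measurable_fun [set: R] (fun x => complex.Re (f x)),
      measurable_fun [set: R] (fun x => complex.Im (f x)) &
      finite_norm (@lebesgue_measure R) p
        (fun x => ComplexField.Normc.normc (f x))].

Definition cintegral (R : realType) (g : R -> R[i]) : R[i] :=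
  (\int[@lebesgue_measure R]_x complex.Re (g x)) +i*
  (\int[@lebesgue_measure R]_x complex.Im (g x)).

Definition L2dot (R : realType) (f g : R -> R[i]) : R[i] :=
  cintegral (fun x => f x * (g x)^*).

Definition cae_eq (R : realType) (f g : R -> R[i]) : Prop :=
  {ae @lebesgue_measure R, forall x, f x = g x}.

Definition test_function (R : realType) (phi : R -> R) : Prop :=
  (forall (n : nat) (x : R), derivable (derive1n n phi) x 1) /\
  compact (closure [set x | phi x != 0]).

(* [v] is the [k]-th distributional derivative of [u].  Real-valued test
   functions suffice, by complex linearity. *)
Definition weak_derivative (R : realType) (k : nat) (u v : R -> R[i]) : Prop :=
  forall phi : R -> R, test_function phi ->
    cintegral (fun x => u x * (derive1n k phi x)%:C) =
    (- 1) ^+ k * cintegral (fun x => v x * (phi x)%:C).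

Definition sobolevH (R : realType) (m : nat) (u : R -> R[i]) : Prop :=
  cLp 2%:E u /\
  forall k : nat, (k <= m)%N ->
    exists2 v : R -> R[i], cLp 2%:E v & weak_derivative k u v.

(* The existential over [u2] is harmless: a locally integrable weak second
   derivative is unique up to a null set. *)
Definition H2_solution (R : realType) (a h : R) (f u : R -> R[i]) : Prop :=
  sobolevH 2 u /\
  exists u2 : R -> R[i],
    [/\ cLp 2%:E u2, weak_derivative 2 u u2 &
        cae_eq (fun x => - u2 x - a%:C * u (x - h)) f].

Definition uniquely_solvable_H2 (R : realType) (a h : R) (f : R -> R[i]) :
    Prop :=
  exists u : R -> R[i], H2_solution a h f u /\
    forall w : R -> R[i], H2_solution a h f w -> cae_eq w u.

Definition expi (R : realType) (t : R) : R[i] := cos t +i* sin t.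

(* Main.v *)
(* Since a and h are real, the real and imaginary parts of the equation
   decouple, and no Fourier transform is needed.  Write S for the shift by h and
   w for the square root of a.  For smooth square integrable phi, integration by
   parts gives the energy identity
     |phi'' + a S phi|^2 = |phi'' + a phi|^2 + a |S phi' - phi'|^2.
   A weak solution of the homogeneous equation, correlated with a test function,
   is a smooth square integrable solution; the identity forces it to satisfy
   phi'' + a phi = 0, hence to vanish.  This gives uniqueness.  By the Riesz
   representation theorem, a weak solution for f exists as soon as |(f, phi)| is
   at most a constant times the norm of L* phi := - phi'' - a phi(. + h).
   - If w h is not a multiple of 2 pi, the identity bounds phi'' + a phi and
     S phi - phi, and variation of constants over one period of the delay then
     bounds phi itself, because (phi, phi') = 0.
   - If w h is a multiple of 2 pi, the orthogonality conditions bound the integral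
     over (y < x) of sin (w (x - y)) f y / w by the tail of |f|, which is square
     integrable as x f is integrable; pairing it with phi'' + a phi yields (f, phi).
     Conversely, testing the equation with a slowly varying cutoff of
     cos (w x) or sin (w x), which is h-periodic, gives the orthogonality.
   The first derivative of a solution u is obtained by solving
   v - v'' = (u - u'')' with the Riesz theorem and identifying v with u'. *)

Require Import Defs.
From HB Require Import structures.
From mathcomp Require Import all_boot all_order all_algebra.
From mathcomp Require Import complex.
From mathcomp Require Import ring lra.
From mathcomp Require Import all_classical all_reals all_analysis.
From mathcomp Require Import measurable_realfun.

Set Implicit Arguments.
Unset Strict Implicit.
Unset Printing Implicit Defensive.

Import Order.TTheory GRing.Theory Num.Theory.
Import numFieldNormedType.Exports.

Local Open Scope ring_scope.
Local Open Scope classical_set_scope.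

(** * Square integrable functions and the Riesz representation theorem *)

Section SquareIntegrable.
Context d (T : measurableType d) (R : realType) (mu : {measure set T -> \bar R}).
Implicit Types f g u v : T -> R.

(** The delay operator is not symmetric and its symbol xi^2 - a e^(- i xi h) has no sign, so it is
    not coercive. What replaces coercivity is that (phi, S phi - phi) = - |S phi - phi|^2 / 2 for a
    shift of either sign: the cross terms of the square recombine into squares. The symbol vanishes
    only where xi^2 = a and e^(i xi h) = 1, hence the two regimes. Uniqueness holds for every h, so
    both halves of the theorem are about existence only; and only u has to be found, since u'' is
    read off the equation as - f - a u(. - h). Away from resonance the constant degenerates like (1
    - cos (w h))^-2, the coefficient that survives when the delay is compared with free oscillation
    over the same time. At resonance a cutoff of slope e is mapped by the adjoint to a function of
    size O(e) on a window of length O(1 / e), whose norm therefore tends to 0. Functions are never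
    identified modulo null sets. Riesz is obtained by minimising |A p|^2 - 2 l p over the test
    functions p themselves, so that neither quotients nor closed subspaces occur. *)

Definition integrableR f := mu.-integrable setT (EFin \o f).
Definition square_integrable f :=
  measurable_fun setT f /\ integrableR (fun x => f x ^+ 2).
Definition inner f g := \int[mu]_x (f x * g x).
Local Notation L2 := square_integrable.
Local Notation dot := inner.

Lemma integrableR_meas f : integrableR f -> measurable_fun setT f.
Proof. by move=> /measurable_int /measurable_EFinP. Qed.

Lemma integrableR_le f g : measurable_fun setT f -> integrableR g ->
  (forall x, `|f x| <= g x) -> integrableR f.
Proof.
move=> mf ig fg; apply: le_integrable ig => //; first exact/measurable_EFinP.
by move=> x _ /=; rewrite lee_fin (le_trans (fg x)) ?ler_norm.
Qed.

Lemma integrableRD f g : integrableR f -> integrableR g ->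
  integrableR (fun x => f x + g x).
Proof. by move=> fi gi; exact: (integrableD measurableT fi gi). Qed.

Lemma integrableRZ c f : integrableR f -> integrableR (fun x => c * f x).
Proof. by move=> fi; exact: (integrableZl measurableT c fi). Qed.

Lemma integrableRN f : integrableR f -> integrableR (fun x => - f x).
Proof. by move=> fi; exact: (integrableN fi). Qed.

Lemma integrableRB f g : integrableR f -> integrableR g ->
  integrableR (fun x => f x - g x).
Proof. by move=> fi /integrableRN; exact: integrableRD. Qed.

Lemma L2_mul f g : L2 f -> L2 g -> integrableR (fun x => f x * g x).
Proof.
move=> [mf f2] [mg g2].
apply: (integrableR_le _ (integrableRD f2 g2)); first exact: measurable_funM.
move=> x; rewrite ler_norml; apply/andP; split; last first.
  have := sqr_ge0 (f x - g x); have := sqr_ge0 (f x); have := sqr_ge0 (g x).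
  rewrite !expr2; nra.
have := sqr_ge0 (f x + g x); have := sqr_ge0 (f x); have := sqr_ge0 (g x).
rewrite !expr2; nra.
Qed.

Lemma L2D f g : L2 f -> L2 g -> L2 (fun x => f x + g x).
Proof.
move=> Lf Lg; have fg := L2_mul Lf Lg; case: Lf Lg => [mf f2] [mg g2].
split; first exact: measurable_funD.
rewrite (_ : (fun _ => _) =
  (fun x => f x ^+ 2 + g x ^+ 2 + 2 * (f x * g x))); last first.
  by apply/funext => x; ring.
by apply: integrableRD; [exact: integrableRD|exact: integrableRZ].
Qed.

Lemma L2Z c f : L2 f -> L2 (fun x => c * f x).
Proof.
move=> [mf f2]; split; first exact: measurable_funM.
under [X in integrableR X]funext do rewrite exprMn.
exact: integrableRZ.
Qed.

Lemma L2N f : L2 f -> L2 (fun x => - f x).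
Proof.
by move=> /(L2Z (-1)); under [X in L2 X]funext do rewrite mulN1r.
Qed.

Lemma L2B f g : L2 f -> L2 g -> L2 (fun x => f x - g x).
Proof. by move=> ? /L2N; exact: L2D. Qed.

Lemma L2_le f g : measurable_fun setT f -> L2 g ->
  (forall x, `|f x| <= `|g x|) -> L2 f.
Proof.
move=> mf [_ g2] fg; split=> //; apply: integrableR_le g2 _.
  exact: measurable_funX.
by move=> x; rewrite normrX -[leRHS]real_normK ?num_real// lerXn2r ?nnegrE.
Qed.

Lemma dotC f g : dot f g = dot g f.
Proof. by apply: eq_Rintegral => x _; rewrite mulrC. Qed.

Lemma dotDl f g v : L2 f -> L2 g -> L2 v ->
  dot (fun x => f x + g x) v = dot f v + dot g v.
Proof.
move=> Lf Lg Lv; rewrite /inner -RintegralD//; try exact: L2_mul.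
by apply: eq_Rintegral => x _; rewrite mulrDl.
Qed.

Lemma dotZl c f v : L2 f -> L2 v -> dot (fun x => c * f x) v = c * dot f v.
Proof.
move=> Lf Lv; rewrite /inner -RintegralZl//; last exact: L2_mul.
by apply: eq_Rintegral => x _; rewrite mulrA.
Qed.

Lemma dotNl f v : L2 f -> L2 v -> dot (fun x => - f x) v = - dot f v.
Proof.
move=> Lf Lv; rewrite -mulN1r -dotZl//; congr dot.
by apply/funext => x; rewrite mulN1r.
Qed.

Lemma dotBl f g v : L2 f -> L2 g -> L2 v ->
  dot (fun x => f x - g x) v = dot f v - dot g v.
Proof. by move=> Lf Lg Lv; rewrite dotDl ?dotNl//; exact: L2N. Qed.

Lemma dotDr f g v : L2 f -> L2 g -> L2 v ->
  dot v (fun x => f x + g x) = dot v f + dot v g.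
Proof. by move=> *; rewrite dotC dotDl// !(dotC v). Qed.

Lemma dotBr f g v : L2 f -> L2 g -> L2 v ->
  dot v (fun x => f x - g x) = dot v f - dot v g.
Proof. by move=> *; rewrite dotC dotBl// !(dotC v). Qed.

Lemma dotZr c f v : L2 f -> L2 v -> dot v (fun x => c * f x) = c * dot v f.
Proof. by move=> *; rewrite dotC dotZl// !(dotC v). Qed.

Lemma dotNr f v : L2 f -> L2 v -> dot v (fun x => - f x) = - dot v f.
Proof. by move=> *; rewrite dotC dotNl// !(dotC v). Qed.

Lemma dot_ge0 f : 0 <= dot f f.
Proof. by apply: Rintegral_ge0 => x _; rewrite -expr2 sqr_ge0. Qed.

Lemma EFin_Rintegral f : integrableR f ->
  ((\int[mu]_x f x)%:E = \int[mu]_x (f x)%:E)%E.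
Proof. by move=> fi; rewrite fineK// integrable_fin_num. Qed.

Lemma dotDD f g : L2 f -> L2 g ->
  dot (fun x => f x + g x) (fun x => f x + g x)
  = dot f f + 2 * dot f g + dot g g.
Proof.
move=> Lf Lg; have Lfg := L2D Lf Lg.
by rewrite dotDl// !dotDr// (dotC g f); ring.
Qed.

Lemma dotBB f g : L2 f -> L2 g ->
  dot (fun x => f x - g x) (fun x => f x - g x)
  = dot f f - 2 * dot f g + dot g g.
Proof.
move=> Lf Lg; have LNg := L2N Lg; rewrite dotDD// !dotNr// dotNl//.
by ring.
Qed.

Lemma cauchy_schwarz f g : L2 f -> L2 g ->
  dot f g ^+ 2 <= dot f f * dot g g.
Proof.
move=> Lf Lg.
have key s t : 0 <= s ^+ 2 * dot f f - 2 * (s * t) * dot f g + t ^+ 2 * dot g g.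
  have := dot_ge0 (fun x => s * f x - t * g x).
  rewrite dotBB; [|exact: L2Z..].
  rewrite !dotZl ?dotZr//; [|exact: L2Z..].
  by rewrite !expr2; lra.
have f0 := dot_ge0 f; have g0 := dot_ge0 g.
(* With A, B, C as set below, the pairs (C, B) and (B, A) turn [key] into C (A C - B^2) >= 0 and A
   (A C - B^2) >= 0. If A and C both vanish, the pair (1, B) gives - 2 B^2 >= 0. *)
have k1 := key (dot g g) (dot f g).
have k2 := key (dot f g) (dot f f).
move: f0 g0 k1 k2.
set A := dot f f; set B := dot f g; set C := dot g g => A0 C0 k1 k2.
have [C0'|] := ltP 0 C.
  have : 0 <= C * (A * C - B ^+ 2) by move: k1; rewrite !expr2; nra.
  by rewrite pmulr_rge0// subr_ge0.
have [A0'|] := ltP 0 A.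
  move=> _; have : 0 <= A * (A * C - B ^+ 2) by move: k2; rewrite !expr2; nra.
  by rewrite pmulr_rge0// subr_ge0.
move=> A0' C0'; have A_0 : A = 0 by lra.
have C_0 : C = 0 by lra.
have k3 := key 1 B; have k4 := key (- 1) B.
move: k3 k4; rewrite -/A -/B -/C A_0 C_0 !expr2; nra.
Qed.

End SquareIntegrable.

(** * Completeness of the square integrable functions, with explicit rates *)

Section RieszFischer.
Context d (T : measurableType d) (R : realType) (mu : {measure set T -> \bar R}).
Implicit Types f g u : T -> R.
Local Notation L2 := (square_integrable mu).
Local Notation dot := (inner mu).

Lemma limn_einf_le (a : (\bar R)^nat) c : (forall n, a n <= c)%E ->
  (limn_einf a <= c)%E.
Proof.
move=> ac; rewrite limn_einf_lim; apply: lime_le; first exact: is_cvg_einfs.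
apply: nearW => n; apply: le_trans (ac n); apply: ereal_inf_lbound.
by exists n => /=.
Qed.

Lemma le0_geometric (x c q : R) : 0 <= q < 1 -> (forall n, x <= c * q ^+ n) ->
  x <= 0.
Proof.
move=> /andP[q0 q1] xle.
have /(cvg_lim (@Rhausdorff R)) <- : geometric c q @ \oo --> (0 : R).
  by apply: cvg_geometric; rewrite ger0_norm.
apply: limr_ge; last by apply: nearW => n; exact: xle.
by apply: cvgP; apply: cvg_geometric; rewrite ger0_norm.
Qed.

(** Since |d| <= 4^n d^2 + 4^-n for every increment d, the increments are absolutely summable. *)
Lemma cvg_of_weighted_squares (a : R^nat) :
  (\sum_(0 <= n <oo) (4 ^+ n * (a n.+1 - a n) ^+ 2)%:E < +oo)%E -> cvgn a.
Proof.
set S := (X in (X < _)%E) => Soo.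
have S0 : (0 <= S)%E.
  by apply: nneseries_ge0 => n _ _; rewrite lee_fin mulr_ge0 ?sqr_ge0 ?exprn_ge0.
have Sfin : S \is a fin_num by rewrite ge0_fin_numE.
rewrite (_ : a = (fun n => a 0%N + series (telescope a) n)); last first.
  by apply/funext => n; exact: eq_sum_telescope.
apply: is_cvgD; first exact: is_cvg_cst.
apply: (@normed_cvg R R^o); apply: nondecreasing_is_cvgn.
  by apply: nondecreasing_series => n _ _ /=.
exists (fine S + 1 * (1 - 4^-1)^-1) => _ [n _ <-] /=.
have q4 : (0 : R) < 4^-1 by rewrite invr_gt0.
have q1 : `|4^-1 : R| < 1 by rewrite ger0_norm ?ltW// invf_lt1// ltr1n.
apply: le_trans (lerD (_ : \sum_(0 <= i < n) (4 ^+ i * (a i.+1 - a i) ^+ 2) <= _)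
  (geometric_le_lim n ler01 q4 q1)).
  rewrite /series/= -big_split/=; apply: ler_sum => i _.
  rewrite /telescope/= mul1r exprVn.
  have q0 : (0 : R) < 4 ^+ i by rewrite exprn_gt0.
  rewrite -(@ler_pM2l _ (4 ^+ i))// mulrDr divff ?gt_eqF//.
  set q := 4 ^+ i in q0 *; set x := a _ - a _.
  rewrite -(real_normK (num_real x)).
  have := sqr_ge0 (q * `|x| - 1); rewrite !expr2.
  have := normr_ge0 x; nra.
rewrite -lee_fin fineK// -sumEFin.
by apply: nneseries_lim_ge => i _ _; rewrite lee_fin mulr_ge0 ?sqr_ge0 ?exprn_ge0.
Qed.

(** The rate 16^-n still leaves 4^-n after weighting by 4^n, so the weighted squared increments are
    summable almost everywhere and the sequence converges there. Fatou's lemma then passes the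
    Cauchy bound to the limit. The explicit rate makes extracting a subsequence unnecessary. *)
Lemma riesz_fischer (v : nat -> T -> R) : (forall n, L2 (v n)) ->
  (forall n m, (n <= m)%N ->
    dot (fun x => v m x - v n x) (fun x => v m x - v n x) <= 16^-1 ^+ n) ->
  exists u, L2 u /\ forall n,
    dot (fun x => u x - v n x) (fun x => u x - v n x) <= 16^-1 ^+ n.
Proof.
move=> Lv vC.
have sqE f : L2 f ->
    ((dot f f)%:E = \int[mu]_x ((f x) ^+ 2)%:E)%E.
  by move=> [mf f2]; rewrite -EFin_Rintegral//; congr EFin; apply: eq_Rintegral => x _;
    rewrite expr2.
pose D n x := ((4 ^+ n * (v n.+1 x - v n x) ^+ 2)%:E : \bar R).
have D0 n x : (0 <= D n x)%E.
  by rewrite lee_fin mulr_ge0 ?sqr_ge0 ?exprn_ge0.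
have mD n : measurable_fun setT (D n).
  apply/measurable_EFinP; apply: measurable_funM => //.
  apply: measurable_funX; apply: measurable_funB; exact: (Lv _).1.
have mS : measurable_fun setT (fun x => \sum_(0 <= n <oo) D n x)%E.
  by apply: ge0_emeasurable_sum => // n x _ _; exact: D0.
have iS : mu.-integrable setT (fun x => \sum_(0 <= n <oo) D n x)%E.
  apply/integrableP; split=> //.
  under eq_integral do rewrite gee0_abs ?nneseries_ge0//.
  rewrite integral_nneseries//.
  apply: (@le_lt_trans _ _ (\sum_(0 <= n <oo) (geometric 1 4^-1 n)%:E)%E).
    apply: lee_nneseries => n _; first by move=> *; apply: integral_ge0 => x _.
    under eq_integral do rewrite /D EFinM.
    rewrite (@ge0_integralZl _ _ _ mu _ measurableT
      (fun x => ((v n.+1 x - v n x) ^+ 2)%:E)); last 3 first.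
    - apply/measurable_EFinP; apply: measurable_funX; apply: measurable_funB; exact: (Lv _).1.
    - by move=> x _; rewrite lee_fin sqr_ge0.
    - by rewrite lee_fin exprn_ge0.
    rewrite -(sqE (fun x => v n.+1 x - v n x)); last exact: L2B.
    rewrite -EFinM lee_fin /geometric /= mul1r.
    have -> : (4^-1 ^+ n : R) = 4 ^+ n * 16^-1 ^+ n.
      by rewrite -exprMn; congr (_ ^+ n); lra.
    by rewrite ler_pM2l ?exprn_gt0//; exact: vC.
  have q4 : (0 : R) < 4^-1 by rewrite invr_gt0.
  have q1 : `|4^-1 : R| < 1 by rewrite ger0_norm ?ltW// invf_lt1// ltr1n.
  apply: (@le_lt_trans _ _ ((1 * (1 - 4^-1)^-1)%:E : \bar R)); last exact: ltry.
  apply: lime_le; first by apply: is_cvg_nneseries => n _ _; rewrite lee_fin /= mul1r exprn_ge0// ltW.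
  by apply: nearW => n; rewrite sumEFin lee_fin geometric_le_lim.
(* A limit superior exists at every point and is measurable; it is the limit wherever the sequence
   converges, and [fine] replaces infinite values by 0. *)
pose u x := fine (limn_esup (fun n => (v n x)%:E)).
have mu_ : measurable_fun setT u.
  apply: (measurableT_comp (@fine_measurable R setT measurableT)).
  apply: measurable_fun_limn_esup => n.
  by apply/measurable_EFinP; exact: (Lv n).1.
have vu : {ae mu, forall x, v n x @[n --> \oo] --> u x}.
  have := integrable_ae measurableT iS.
  apply: filterS => x /(_ I) Sx.
  have /cvg_ex[l vl] : cvgn (v ^~ x).
    apply: cvg_of_weighted_squares; rewrite -ge0_fin_numE; first exact: Sx.
    by apply: nneseries_ge0 => n _ _; exact: D0.
  suff -> : u x = l by [].
  have vl' : (v n x)%:E @[n --> \oo] --> l%:E.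
    by apply: cvg_EFin => //; exact: nearW.
  rewrite /u is_cvg_limn_esupE; last exact: cvgP vl'.
  by rewrite (cvg_lim _ vl').
have uv n : (\int[mu]_x (((u x - v n x) ^+ 2)%:E) <= (16^-1 ^+ n)%:E)%E.
  pose F m x := (((v (n + m)%N x - v n x) ^+ 2)%:E : \bar R).
  have F0 m x : (0 <= F m x)%E by rewrite lee_fin sqr_ge0.
  have mF m : measurable_fun setT (F m).
    apply/measurable_EFinP; apply: measurable_funX; apply: measurable_funB; exact: (Lv _).1.
  have Fu : {ae mu, forall x, limn_einf (F ^~ x) = ((u x - v n x) ^+ 2)%:E}.
    apply: filterS vu => x vux.
    suff Fx : F m x @[m --> \oo] --> ((u x - v n x) ^+ 2)%:E.
      rewrite is_cvg_limn_einfE; last exact: cvgP Fx.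
      by rewrite (cvg_lim _ Fx).
    apply: cvg_EFin; first exact: nearW.
    rewrite /F /comp /=.
    have h : v (n + m)%N x - v n x @[m --> \oo] --> u x - v n x.
      apply: cvgB; last exact: cvg_cst.
      rewrite (_ : (fun m => _) = (fun m => v (m + n)%N x)); last first.
        by apply/funext => m; rewrite addnC.
      by rewrite (cvg_shiftn n (v ^~ x)).
    by under eq_cvg do rewrite expr2; rewrite expr2; exact: (cvgM h h).
  apply: (@le_trans _ _ (\int[mu]_x limn_einf (F ^~ x))%E).
    rewrite le_eqVlt; apply/orP; left; apply/eqP; apply: ae_eq_integral => //.
    - apply/measurable_EFinP; apply: measurable_funX; apply: measurable_funB => //; exact: (Lv _).1.
    - rewrite /limn_einf; apply: measurableT_comp => //.
      apply: measurable_fun_limn_esup => m .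
      exact: (measurableT_comp (@oppe_measurable R setT) (mF m)).
    - by apply: filterS Fu => x -> _.
  apply: le_trans (fatou _ _ _ _) _ => //.
  apply: limn_einf_le => m.
  rewrite -(sqE (fun x => v (n + m)%N x - v n x)); last exact: L2B.
  by rewrite lee_fin; apply: vC; rewrite leq_addr.
have Luv n : L2 (fun x => u x - v n x).
  split; first by apply: measurable_funB => //; exact: (Lv _).1.
  apply/integrableP; split.
    apply/measurable_EFinP; apply: measurable_funX; apply: measurable_funB => //; exact: (Lv _).1.
  under eq_integral do rewrite /= ger0_norm ?sqr_ge0//.
  by apply: le_lt_trans (uv n) _; exact: ltry.
exists u; split; last by move=> n; rewrite -lee_fin sqE.
have -> : u = fun x => (u x - v 0%N x) + v 0%N x by apply/funext => x; rewrite subrK.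
exact: L2D.
Qed.

End RieszFischer.

(** * Riesz representation by minimisation *)

Section Riesz.
Context d (T : measurableType d) (R : realType) (mu : {measure set T -> \bar R}).
Local Notation L2 := (square_integrable mu).
Local Notation dot := (inner mu).

(** The minimum over t is at - D / N; dividing by N + 1 instead covers N = 0 at the cost of a
    slightly weaker bound. *)
Lemma quadratic_ge0 (e D N : R) : 0 <= N ->
  (forall t, 0 <= e + 2 * t * D + t ^+ 2 * N) -> D ^+ 2 <= e * (N + 1).
Proof.
move=> N0 /(_ (- D / (N + 1))).
have N1 : 0 < N + 1 by lra.
rewrite -(@ler_pM2r _ ((N + 1) ^+ 2)) ?exprn_gt0// mul0r.
rewrite [X in 0 <= X -> _](_ : _ = e * (N + 1) ^+ 2 - D ^+ 2 * (N + 2)); last first.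
  by field; lra.
move=> h; rewrite -(@ler_pM2r _ (N + 1))//.
have := sqr_ge0 D; move: h; rewrite !expr2; nra.
Qed.

(** [V] only parametrises the range of [A], which need not be closed. The representative is the
    limit of [A p] along a minimising sequence of the quadratic functional [J], and the vanishing
    first variation of [J] in the direction q reads (u, A q) = l q. *)
Lemma riesz_representation (V : lmodType R) (P : set V) (A : V -> T -> R)
    (l : V -> R) (C : R) :
  (exists z, P z) ->
  (forall p q c, P p -> P q -> P (p + c *: q)) ->
  (forall p, P p -> L2 (A p)) ->
  (forall p q c, P p -> P q -> A (p + c *: q) = fun x => A p x + c * A q x) ->
  (forall p q c, P p -> P q -> l (p + c *: q) = l p + c * l q) ->
  (forall p, P p -> l p ^+ 2 <= C * dot (A p) (A p)) ->
  exists u, L2 u /\ forall p, P p -> l p = dot u (A p).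
Proof.
move=> [z Pz] PD LA AD lD lC.
have C'0 : exists2 C', 0 <= C' &
    forall p, P p -> l p ^+ 2 <= C' * dot (A p) (A p).
  exists `|C|; first exact: normr_ge0.
  move=> p Pp; apply: le_trans (lC _ Pp) _.
  by rewrite ler_wpM2r ?dot_ge0// ler_norm.
move: C'0 => {C lC} [C C0 lC].
pose J p := dot (A p) (A p) - 2 * l p.
(* 2 |l p| <= 2 sqrt(C) |A p| <= C + |A p|^2. *)
have JC p : P p -> - C <= J p.
  move=> Pp; have := lC _ Pp; have := dot_ge0 mu (A p); rewrite /J.
  set N := dot _ _; set y := l p => N0 yCN.
  have : (2 * y) ^+ 2 <= (C + N) ^+ 2.
    have := sqr_ge0 (C - N); move: yCN; rewrite !expr2; nra.
  rewrite -[leRHS]real_normK ?num_real// -[leLHS]real_normK ?num_real//.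
  rewrite ler_pXn2r// ?nnegrE// => h.
  have := ler_norm (2 * y); move: h; rewrite [X in _ <= X]ger0_norm; lra.
pose I := inf (J @` P).
have hJ : has_inf (J @` P).
  by split; [exists (J z), z|exists (- C) => _ [p Pp <-]; exact: JC].
have IJ p : P p -> I <= J p by move=> Pp; apply: (ge_inf hJ.2); exists p.
(* By the parallelogram identity at the midpoint, two points within e_n of the infimum have images
   at squared distance at most 4 e_n; the factor 1/4 makes this the rate of [riesz_fischer]. *)
pose e n : R := 4^-1 * 16^-1 ^+ n.
have e0 n : 0 < e n by rewrite mulr_gt0 ?invr_gt0// exprn_gt0// invr_gt0.
have /choice[p pP] n : exists p, P p /\ J p < I + e n.
  have [_ [p Pp <-] Jp] := inf_adherent (e0 n) hJ; by exists p.
have Pp n : P (p n) by case: (pP n).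
have JD q r c : P q -> P r -> J (q + c *: r) =
    J q + 2 * c * (dot (A q) (A r) - l r) + c ^+ 2 * dot (A r) (A r).
  move=> Pq Pr; rewrite /J AD// lD// dotDD; [|exact: LA|exact/L2Z/LA].
  rewrite !dotZr ?dotZl//; try exact: LA; try exact/L2Z/LA.
  ring.
have vC n m : (n <= m)%N -> dot (fun x => A (p m) x - A (p n) x)
    (fun x => A (p m) x - A (p n) x) <= 16^-1 ^+ n.
  move=> nm; rewrite dotBB; [|exact: LA..].
  have Pd : P (p m + (-1) *: p n) by exact: PD.
  have Pmid : P (p n + 2^-1 *: (p m + (-1) *: p n)) by exact: PD.
  have := IJ _ Pmid; rewrite JD// AD// lD//.
  rewrite dotDD ?dotDr ?dotZr ?dotZl ?dotZr; try exact: LA; try exact/L2Z/LA.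
  have emn : e m <= e n.
    rewrite /e ler_pM2l ?invr_gt0//; apply: ler_wiXn2l => //.
    by rewrite invf_le1// ler1n.
  have : 16^-1 ^+ n = 4 * e n by rewrite /e mulrA divff ?mul1r.
  have := (pP n).2; have := (pP m).2; rewrite /J.
  rewrite (dotC _ (A (p n)) (A (p m))) => h1 h2 -> h3.
  move: (e n) (e m) emn h1 h2 h3 => en em.
  lra.
have [u [Lu uv]] := riesz_fischer (fun n => LA _ (Pp n)) vC.
exists u; split => // q Pq.
have N0 := dot_ge0 mu (A q).
set N := dot (A q) (A q) in N0.
have Dn n : (dot (A (p n)) (A q) - l q) ^+ 2 <= e n * (N + 1).
  apply: quadratic_ge0 => // t.
  have := IJ _ (PD _ _ t (Pp n) Pq); rewrite JD// -/N.
  have := (pP n).2; lra.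
have Un n : (dot u (A q) - dot (A (p n)) (A q)) ^+ 2 <= 16^-1 ^+ n * (N + 1).
  rewrite -dotBl//; try exact: LA.
  apply: (le_trans (cauchy_schwarz _ _)); [exact/L2B/LA|exact: LA|].
  rewrite ler_pM//; [exact: dot_ge0|by rewrite lerDl].
suff : (dot u (A q) - l q) ^+ 2 <= 0.
  by move=> h; apply/esym/eqP; rewrite -subr_eq0 -sqrf_eq0 eq_le h sqr_ge0.
apply: (@le0_geometric _ _ (4 * (N + 1)) 16^-1).
  by rewrite invr_ge0 invf_lt1// ler0n ltr1n.
move=> n; have := Dn n; have := Un n; rewrite /e.
have : (0 : R) < 16^-1 ^+ n by rewrite exprn_gt0// invr_gt0.
move: (16^-1 ^+ n) (dot (A (p n)) _) (dot u _) (l q) => w b a c w0 h1 h2.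
have := sqr_ge0 ((a - b) - (b - c)); move: h1 h2; rewrite !expr2; nra.
Qed.

End Riesz.

(** * Translation invariance and smooth functions *)

Section Translation.
Context {R : realType}.
Local Notation mu := (@lebesgue_measure R).
Local Notation L2 := (square_integrable mu).
Local Notation dot := (inner mu).
Implicit Types (f : R -> R) (c : R).

Lemma measurable_shift c : measurable_fun [set: R] (fun x : R => x + c).
Proof. exact: measurable_funD. Qed.

(** Both measures give half-open intervals their length, and Lebesgue measure is the only one that
    does. *)
Lemma lebesgue_measure_shift c (A : set R) : measurable A ->
  mu A = pushforward mu (fun x : R => x + c) A.
Proof.
pose phi : measurableTypeR R -> measurableTypeR R := fun x => x + c.
have mphi : measurable_fun [set: measurableTypeR R] phi by exact: measurable_shift.
pose m0 := [the measure _ _ of pushforward mu phi].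
pose m := m0 mphi.
have h X : ocitv X -> lebesgue_measure X = m X.
  move=> [[a b] _ <-]; rewrite /m/= /pushforward/=.
  rewrite (_ : phi @^-1` _ = `]a - c, b - c]%classic); last first.
    by apply/seteqP; split=> x /=; rewrite /phi !in_itv/= ltrBlDr lerBrDr.
  rewrite !lebesgue_measure_itv/= !lte_fin ltrD2r; case: ifP => // _.
  by rewrite -!EFinB; congr EFin; lra.
move=> mA; exact: (lebesgue_measure_unique h mA).
Qed.

Lemma ge0_integral_shift c (f : R -> \bar R) : measurable_fun [set: R] f ->
  (forall x, 0 <= f x)%E -> (\int[mu]_x f (x + c)%R = \int[mu]_x f x)%E.
Proof.
move=> mf f0.
pose phi : measurableTypeR R -> measurableTypeR R := fun x => x + c.
have mphi : measurable_fun [set: measurableTypeR R] phi by exact: measurable_shift.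
have := @ge0_integral_pushforward _ _ _ _ _ phi mphi mu setT f measurableT mf.
move=> <-; last by move=> y _; exact: f0.
apply: eq_measure_integral => A mA _; apply/esym.
exact: lebesgue_measure_shift.
Qed.

Lemma integrableR_shift c f : integrableR mu f ->
  integrableR mu (fun x => f (x + c)).
Proof.
move=> /integrableP[/measurable_EFinP mf fi]; apply/integrableP; split.
  apply/measurable_EFinP; apply: (measurableT_comp mf); exact: measurable_shift.
rewrite (@ge0_integral_shift c (fun x => `|(f x)%:E|%E))//.
by apply/measurable_EFinP; exact: measurableT_comp.
Qed.

Lemma Rintegral_shift c f : integrableR mu f ->
  \int[mu]_x f (x + c) = \int[mu]_x f x.
Proof.
move=> fi.
have mf := integrableR_meas fi.
have mE : measurable_fun [set: R] (EFin \o f) by exact/measurable_EFinP.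
rewrite /Rintegral; congr fine; rewrite integralE [RHS]integralE; congr (_ - _)%E.
- rewrite -[RHS](@ge0_integral_shift c (EFin \o f)^\+%E); [|exact: measurable_funepos|exact: funepos_ge0].
  by apply: eq_integral => x _; rewrite !funeposE.
- rewrite -[RHS](@ge0_integral_shift c (EFin \o f)^\-%E); [|exact: measurable_funeneg|exact: funeneg_ge0].
  by apply: eq_integral => x _; rewrite !funenegE.
Qed.

Lemma L2_shift c f : L2 f -> L2 (fun x => f (x + c)).
Proof.
move=> [mf f2]; split; last exact: (integrableR_shift c f2).
by apply: (measurableT_comp mf); exact: measurable_shift.
Qed.

Lemma dot_shift c f g : L2 f -> L2 g ->
  dot (fun x => f (x + c)) (fun x => g (x + c)) = dot f g.
Proof. by move=> Lf Lg; exact: (Rintegral_shift c (L2_mul Lf Lg)). Qed.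

End Translation.

(** * Calculus of smooth functions *)

Section Smooth.
Context {R : realType}.
Implicit Types (f g : R -> R) (c x : R).

Definition smooth f := forall n x, derivable (derive1n n f) x 1.

Lemma derive1_val f x df : is_derive x 1 f df -> derive1 f x = df.
Proof. by move=> h; rewrite derive1E derive_val. Qed.

Lemma is_derive1 f x : derivable f x 1 -> is_derive x 1 f (derive1 f x).
Proof. by move=> h; rewrite derive1E; exact: derivableP. Qed.

Lemma smooth_deriv f : smooth f -> smooth (derive1 f).
Proof. by move=> sf n x; rewrite -derive1Sn; exact: sf. Qed.

Lemma smooth_derivable f x : smooth f -> derivable f x 1.
Proof. by move=> /(_ 0%N x). Qed.

Lemma smooth_is_derive f x : smooth f -> is_derive x 1 f (derive1 f x).
Proof. by move=> sf; apply: is_derive1; exact: smooth_derivable. Qed.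

Lemma smooth_continuous f : smooth f -> continuous f.
Proof.
move=> sf x; apply: differentiable_continuous.
by apply/derivable1_diffP; exact: smooth_derivable.
Qed.

(** A coinduction principle: constants, trigonometric sums, correlations and the functions [flat p]
    are shown smooth by exhibiting a class of functions closed under differentiation. *)
Lemma smooth_ind (Q : (R -> R) -> Prop) :
  (forall f, Q f -> (forall x, derivable f x 1) /\ Q (derive1 f)) ->
  forall f, Q f -> smooth f.
Proof.
move=> QP f Qf n; suff: Q (derive1n n f) by case/QP.
by elim: n => // n IH; rewrite derive1nS; case: (QP _ IH).
Qed.

(** The recursion peels off the innermost derivative, so that sums and products are handled by
    induction from the Leibniz rule at order one, without a binomial formula. *)
Fixpoint diffn n f : Prop :=
  if n is n'.+1 then (forall x, derivable f x 1) /\ diffn n' (derive1 f) else True.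

Lemma smoothP f : smooth f <-> forall n, diffn n f.
Proof.
split=> [sf n|].
  by elim: n f sf => //= n IH f sf; split; [exact: (sf 0%N)|exact/IH/smooth_deriv].
move=> df n x; elim: n f df => [f /(_ 1%N)[]//|n IH f df].
by rewrite derive1Sn; apply: IH => m; case: (df m.+1).
Qed.

Lemma diffnW n f : diffn n.+1 f -> diffn n f.
Proof. by elim: n f => // n IH f [df /IH]. Qed.

Lemma deriv1D f g : (forall x, derivable f x 1) -> (forall x, derivable g x 1) ->
  derive1 (fun x => f x + g x) = (fun x => derive1 f x + derive1 g x).
Proof.
move=> df dg; apply/funext => x; apply: derive1_val.
by apply: is_deriveD; exact: is_derive1.
Qed.

Lemma deriv1M f g : (forall x, derivable f x 1) -> (forall x, derivable g x 1) ->
  derive1 (fun x => f x * g x) = (fun x => f x * derive1 g x + derive1 f x * g x).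
Proof.
move=> df dg; apply/funext => x; apply: derive1_val.
have hf := is_derive1 (df x); have hg := is_derive1 (dg x).
refine (is_derive_eq (is_deriveM hf hg) _); rewrite /GRing.scale/=; ring.
Qed.

Lemma diffnD n f g : diffn n f -> diffn n g -> diffn n (fun x => f x + g x).
Proof.
elim: n f g => //= n IH f g [df dnf] [dg dng]; split.
  by move=> x; exact: derivableD.
by rewrite deriv1D//; exact: IH.
Qed.

Lemma diffnM n f g : diffn n f -> diffn n g -> diffn n (fun x => f x * g x).
Proof.
elim: n f g => // n IH f g df dg.
have [/= df1 dfn] := df; have [/= dg1 dgn] := dg; split.
  by move=> x; exact: derivableM.
by rewrite deriv1M//; apply: diffnD; apply: IH => //; exact: diffnW.
Qed.

Lemma smoothD f g : smooth f -> smooth g -> smooth (fun x => f x + g x).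
Proof. by move=> /smoothP sf /smoothP sg; apply/smoothP => n; exact: diffnD. Qed.

Lemma smoothM f g : smooth f -> smooth g -> smooth (fun x => f x * g x).
Proof. by move=> /smoothP sf /smoothP sg; apply/smoothP => n; exact: diffnM. Qed.

Lemma smooth_cst c : smooth (fun=> c).
Proof.
apply: (@smooth_ind (fun f => exists c, f = fun=> c)); last by exists c.
move=> _ [{}c ->]; split; first by move=> x; exact: derivable_cst.
by exists 0; apply/funext => x; apply: derive1_val; exact: is_derive_cst.
Qed.

Lemma smoothZ c f : smooth f -> smooth (fun x => c * f x).
Proof. by apply: smoothM; exact: smooth_cst. Qed.

Lemma smoothN f : smooth f -> smooth (fun x => - f x).
Proof.
by move=> /(@smoothZ (-1)); under [X in smooth X -> _]funext do rewrite mulN1r.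
Qed.

Lemma smoothB f g : smooth f -> smooth g -> smooth (fun x => f x - g x).
Proof. by move=> sf /smoothN; exact: smoothD. Qed.

Lemma derive1nD n f g : smooth f -> smooth g ->
  derive1n n (fun x => f x + g x) = fun x => derive1n n f x + derive1n n g x.
Proof.
move=> sf sg; elim: n => // n IH; rewrite !derive1nS IH deriv1D//.
Qed.

Lemma is_derive_affine f x c k : derivable f (c * x + k) 1 ->
  is_derive x 1 (fun x => f (c * x + k)) (c * derive1 f (c * x + k)).
Proof.
move=> df; have dd : is_derive x 1 (fun x => c * x + k) c.
  by apply: is_derive_eq; rewrite addr0 /GRing.scale/= mulr1.
rewrite mulrC; have := is_derive1 df => df'.
have := @is_derive1_comp _ f (fun x => c * x + k) x (derive1 f (c * x + k)) c df' dd.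
by [].
Qed.

Lemma derive1n_affine n f c k : smooth f ->
  derive1n n (fun x => f (c * x + k)) = fun x => c ^+ n * derive1n n f (c * x + k).
Proof.
move=> sf; elim: n => [|n IH]; first by apply/funext => x; rewrite mul1r.
rewrite !derive1nS IH; apply/funext => x; apply: derive1_val.
have h := is_derive_affine (sf n (c * x + k)).
by apply: is_derive_eq; rewrite /GRing.scale/= exprSr mulrA.
Qed.

Lemma smooth_affine f c k : smooth f -> smooth (fun x => f (c * x + k)).
Proof.
move=> sf n x; rewrite derive1n_affine//.
have h := is_derive_affine (sf n (c * x + k)).
by apply: derivableZ; exact: ex_derive.
Qed.

Lemma is_derive_trig a b w x :
  is_derive x (1 : R) (fun x => a * cos (w * x) + b * sin (w * x))
    ((b * w) * cos (w * x) + (- a * w) * sin (w * x)).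
Proof.
have dw : is_derive x 1 (fun x => w * x) w.
  by apply: is_derive_eq; rewrite /GRing.scale/= mulr1.
have dc := @is_derive1_comp _ cos (fun x => w * x) x _ _ (is_derive_cos (w * x)) dw.
have ds := @is_derive1_comp _ sin (fun x => w * x) x _ _ (is_derive_sin (w * x)) dw.
have dd := is_deriveD (is_deriveZ a dc) (is_deriveZ b ds).
refine (is_derive_eq dd _); rewrite /GRing.scale/=; ring.
Qed.

Lemma derive1_trig a b w :
  derive1 (fun x => a * cos (w * x) + b * sin (w * x)) =
  fun x => (b * w) * cos (w * x) + (- a * w) * sin (w * x).
Proof. by apply/funext => x; exact: derive1_val (is_derive_trig a b w x). Qed.

Lemma smooth_trig a b w : smooth (fun x => a * cos (w * x) + b * sin (w * x)).
Proof.
apply: (@smooth_ind (fun f => exists a b,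
  f = fun x => a * cos (w * x) + b * sin (w * x))); last by exists a, b.
move=> _ [{}a [{}b ->]]; split.
  by move=> x; apply: ex_derive; exact: is_derive_trig.
by exists (b * w), (- a * w); exact: derive1_trig.
Qed.

End Smooth.

(** * Fubini for real integrals and the fundamental theorem of calculus on the line *)

Section RealFubini.
Context {R : realType}.
Local Notation mu := (@lebesgue_measure R).
Implicit Types (f K : R -> R) (h : R * R -> R).

Lemma integrable_prod h : measurable_fun [set: R * R] h ->
  (\int[mu]_y \int[mu]_x `|(h (x, y))%:E| < +oo)%E ->
  (mu \x mu)%E.-integrable setT (EFin \o h).
Proof.
move=> mh hoo.
have mE : measurable_fun [set: R * R] (EFin \o h) by exact/measurable_EFinP.
exact: (integrable21ltyP mu mu mE).2.
Qed.

Lemma fine_integrable (F : R -> \bar R) : mu.-integrable setT F ->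
  integrableR mu (fine \o F) /\ (\int[mu]_x (fine (F x))%:E = \int[mu]_x F x)%E.
Proof.
move=> iF; have mF := measurable_int _ iF.
have mf : measurable_fun [set: R] (fun x => (fine (F x))%:E).
  apply/measurable_EFinP.
  exact: (measurableT_comp (@fine_measurable R setT measurableT) mF).
have aeF : {ae mu, forall x, setT x -> (fine (F x))%:E = F x}.
  by apply: filterS (integrable_ae measurableT iF) => x /(_ I) Fx _; rewrite fineK.
split; last exact: ae_eq_integral.
apply/integrableP; split=> //=.
move/integrableP : (iF) => [_]; apply: le_lt_trans.
rewrite le_eqVlt; apply/orP; left; apply/eqP.
apply: ae_eq_integral => //; [|exact: measurableT_comp|].
  by apply/measurable_EFinP; apply: measurableT_comp => //; exact/measurable_EFinP.
apply: (@filterS _ _ (ae_filter_ringOfSetsType mu) _ _ _ aeF) => x /(_ I) h _; by rewrite -[in RHS]h.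
Qed.

(** The inner integrals are finite only almost everywhere; [fine] puts 0 at the exceptional points,
    which leaves the outer integrals unchanged. *)
Lemma Rfubini h : (mu \x mu)%E.-integrable setT (EFin \o h) ->
  [/\ integrableR mu (fun x => \int[mu]_y h (x, y)),
      integrableR mu (fun y => \int[mu]_x h (x, y)) &
  \int[mu]_x \int[mu]_y h (x, y) = \int[mu]_y \int[mu]_x h (x, y)].
Proof.
move=> ih.
have iF := integrable_fubini_F ih.
have [if1 eF] := fine_integrable iF.
have iG : mu.-integrable setT (fun y => \int[mu]_x (h (x, y))%:E)%E.
  apply/integrableP; split; first exact: (measurable_fubini_G ih).
  have mh : measurable_fun setT (EFin \o h) by exact: (measurable_int _ ih).
  apply: le_lt_trans ((integrable21ltyP mu mu mh).1 ih).
  apply: ge0_le_integral => //.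
  - by apply: measurableT_comp => //; exact: (measurable_fubini_G ih).
  - have mah : measurable_fun setT (abse \o (EFin \o h)) by exact: measurableT_comp.
    exact: (@measurable_fun_fubini_tonelli_G _ _ _ _ _ mu _ mah (fun z => abse_ge0 _)).
  - move=> y _; apply: le_abse_integral => //.
    apply/measurable_EFinP; move/measurable_EFinP : mh => mh.
    by apply: measurableT_comp mh _; exact: pair2_measurable.
have [ig1 eG] := fine_integrable iG.
split; [exact: if1|exact: ig1|].
by rewrite /Rintegral; congr fine; rewrite eF eG; exact: (Fubini ih).
Qed.

Lemma measurable_add2 : measurable_fun [set: R * R] (fun z => z.1 + z.2 : R).
Proof. exact: measurable_funD. Qed.

Lemma integrable_shift_prod f K : integrableR mu f -> integrableR mu K ->
  (mu \x mu)%E.-integrable setT (EFin \o (fun z : R * R => f (z.1 + z.2) * K z.2)).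
Proof.
move=> fi Ki; have mf := integrableR_meas fi; have mK := integrableR_meas Ki.
apply: integrable_prod.
  apply: measurable_funM.
    exact: (measurableT_comp mf measurable_add2).
  exact: (measurableT_comp mK measurable_snd).
move/integrableP : fi => [_ foo]; move/integrableP : Ki => [_ Koo].
rewrite (_ : integral _ _ _ = (\int[mu]_x `|(f x)%:E|) * \int[mu]_y `|(K y)%:E|)%E.
  rewrite lte_mul_pinfty//; first exact: integral_ge0.
  by rewrite ge0_fin_numE// integral_ge0.
rewrite -(@ge0_integralZl _ _ _ mu _ measurableT (fun y => `|(K y)%:E|%E)); last 3 first.
- by apply/measurable_EFinP; exact: measurableT_comp.
- by move=> x _; exact: abse_ge0.
- exact: integral_ge0.
apply: eq_integral => y _ /=.
under eq_integral do rewrite normrM EFinM.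
rewrite ge0_integralZr//.
  rewrite (@ge0_integral_shift _ y (fun x => `|(f x)%:E|%E))//.
  by apply/measurable_EFinP; exact: measurableT_comp.
apply/measurable_EFinP; apply: measurableT_comp => //.
by apply: (measurableT_comp mf); exact: measurable_shift.
Qed.

(** Averaging over translations. It serves with the indicator of an interval as [K], in
    [integral_deriv0] and in [L2_window]. *)
Lemma Rfubini_shift f K : integrableR mu f -> integrableR mu K ->
  integrableR mu (fun x => \int[mu]_t (f (x + t) * K t)) /\
  \int[mu]_x \int[mu]_t (f (x + t) * K t) = \int[mu]_x f x * \int[mu]_t K t.
Proof.
move=> fi Ki.
have [i1 _ /= e] := Rfubini (integrable_shift_prod fi Ki).
split; first exact: i1.
rewrite e -RintegralZl//; apply: eq_Rintegral => t _.
rewrite RintegralZr//; last exact: integrableR_shift.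
by rewrite Rintegral_shift// mulrC.
Qed.

Lemma Rintegral_indic (D : set R) f : measurable D ->
  \int[mu]_(x in D) f x = \int[mu]_x (f x * \1_D x).
Proof. by move=> mD; rewrite Rintegral_mkcond patch_indic. Qed.

Lemma Rintegral_indic1 (a b : R) : a <= b -> \int[mu]_x \1_`[a, b] x = b - a.
Proof.
move=> ab; rewrite /Rintegral integral_indic// setIT/= lebesgue_measure_itv/= lte_fin.
case: ltP => // ba.
have -> : a = b by apply/eqP; rewrite eq_le ab.
by rewrite subrr.
Qed.

Lemma integrableR_indic (a b : R) : integrableR mu (\1_`[a, b]).
Proof.
by apply: integrable_indic_itv.
Qed.

Lemma ftc_smooth f (a b : R) : smooth f -> a <= b ->
  \int[mu]_(x in `[a, b]) (derive1 f x) = f b - f a.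
Proof.
move=> sf; rewrite le_eqVlt => /predU1P[->|ab].
  by rewrite set_itv1 Rintegral_set1 subrr.
have cf := smooth_continuous sf.
rewrite /Rintegral (@continuous_FTC2 _ (derive1 f) f)//.
- by apply: continuous_subspaceT; exact/smooth_continuous/smooth_deriv.
- split; first by move=> x _; exact: smooth_derivable.
  + by apply: cvg_at_right_filter; exact: cf.
  + by apply: cvg_at_left_filter; exact: cf.
Qed.

(** Averaging the derivative over unit translations does not change its integral, and turns it into
    the integral of f(x + 1) - f(x), which is 0 by translation invariance. No limit of f at infinity
    is discussed. *)
Lemma integral_deriv0 f : smooth f -> integrableR mu f ->
  integrableR mu (derive1 f) -> \int[mu]_x (derive1 f x) = 0.
Proof.
move=> sf fi dfi.
have [_ e] := Rfubini_shift dfi (integrableR_indic 0 1).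
rewrite Rintegral_indic1// subr0 mulr1 in e.
rewrite -e (_ : (fun x => _) = (fun x => f (x + 1) - f x)); last first.
  apply/funext => x; rewrite -Rintegral_indic; last exact: measurable_itv.
  have sfx : smooth (fun t => f (1 * t + x)) by exact: smooth_affine.
  have := ftc_smooth sfx ler01; rewrite mul1r mulr0 add0r [1 + x]addrC => <-.
  apply: eq_Rintegral => t _.
  have /derive1_val -> := is_derive_affine (@smooth_derivable _ f (1 * t + x) sf).
  by rewrite !mul1r addrC.
by rewrite RintegralB// ?Rintegral_shift// ?subrr//; exact: integrableR_shift.
Qed.

End RealFubini.

(** * The energy identity *)

Section SmoothL2.
Context {R : realType}.
Local Notation mu := (@lebesgue_measure R).
Local Notation L2 := (square_integrable mu).
Local Notation dot := (inner mu).
Implicit Types (f g w : R -> R) (a s c : R).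

Definition smoothL2 f := smooth f /\ forall n, L2 (derive1n n f).

Lemma smoothL2_L2 f : smoothL2 f -> L2 f.
Proof. by move=> [_ /(_ 0%N)]. Qed.

Lemma smoothL2_deriv f : smoothL2 f -> smoothL2 (derive1 f).
Proof.
by move=> [sf f2]; split; [exact: smooth_deriv|move=> n; rewrite -derive1Sn].
Qed.

Lemma derive1n_shift n f s : smooth f ->
  derive1n n (fun x => f (x + s)) = fun x => derive1n n f (x + s).
Proof.
move=> sf; have := derive1n_affine n 1 s sf.
under [X in derive1n n X]funext do rewrite mul1r.
by move=> ->; apply/funext => x; rewrite expr1n !mul1r.
Qed.

Lemma derive1_shift f s : smooth f ->
  derive1 (fun x => f (x + s)) = fun x => derive1 f (x + s).
Proof. exact: (@derive1n_shift 1). Qed.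

Lemma smooth_shift f s : smooth f -> smooth (fun x => f (x + s)).
Proof.
by move=> sf; have := @smooth_affine _ f 1 s sf;
  under [X in smooth X]funext do rewrite mul1r.
Qed.

Lemma smoothL2_shift s f : smoothL2 f -> smoothL2 (fun x => f (x + s)).
Proof.
move=> [sf f2]; split; first exact: smooth_shift.
by move=> n; rewrite derive1n_shift//; exact: (L2_shift s (f2 n)).
Qed.

(** A product of two square integrable functions is integrable, so [integral_deriv0] applies to f g
    and there is no boundary term. *)
Lemma integration_by_parts_L2 f g : smoothL2 f -> smoothL2 g ->
  dot (derive1 f) g = - dot f (derive1 g).
Proof.
move=> Wf Wg; have [[sf _] [sg _]] := (Wf, Wg).
have [W'f W'g] := (smoothL2_deriv Wf, smoothL2_deriv Wg).
have i1 := L2_mul (smoothL2_L2 Wf) (smoothL2_L2 W'g).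
have i2 := L2_mul (smoothL2_L2 W'f) (smoothL2_L2 Wg).
have e : derive1 (fun x => f x * g x) =
    fun x => f x * derive1 g x + derive1 f x * g x.
  by apply: deriv1M => x; exact: smooth_derivable.
have : \int[mu]_x (derive1 (fun x => f x * g x) x) = 0.
  apply: integral_deriv0.
  - exact: smoothM.
  - exact: L2_mul (smoothL2_L2 Wf) (smoothL2_L2 Wg).
  - by rewrite e; exact: integrableRD.
by rewrite e RintegralD// => /eqP; rewrite addrC addr_eq0 => /eqP.
Qed.

(** Translation preserves the norm, hence |S f - f|^2 = 2 |f|^2 - 2 (f, S f), whatever the sign of
    [s]. *)
Lemma dot_shift_diff s f : L2 f ->
  dot f (fun x => f (x + s) - f x) =
  - 2^-1 * dot (fun x => f (x + s) - f x) (fun x => f (x + s) - f x).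
Proof.
move=> Lf; have Lfs := L2_shift s Lf.
rewrite dotBB// dotBr// (dot_shift s Lf Lf) (dotC mu (fun x => f (x + s)) f).
by lra.
Qed.

(* The Fourier form of this identity is
   |xi^2 - a e^(i xi s)|^2 = (xi^2 - a)^2 + a xi^2 |e^(i xi s) - 1|^2. *)
Lemma energy_identity a s f : smoothL2 f ->
  let F := fun x => derive1 (derive1 f) x + a * f (x + s) in
  let G := fun x => derive1 (derive1 f) x + a * f x in
  let D := fun x => derive1 f (x + s) - derive1 f x in
  dot F F = dot G G + a * dot D D.
Proof.
move=> Wf F G D.
have W1 := smoothL2_deriv Wf; have W2 := smoothL2_deriv W1.
have L0 := smoothL2_L2 Wf; have L1 := smoothL2_L2 W1; have L_2 := smoothL2_L2 W2.
pose E := fun x => f (x + s) - f x.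
have WE : smoothL2 E.
  have [sf f2] := Wf; have [sfs fs2] := smoothL2_shift s Wf; split.
    exact: smoothB.
  have EE : E = fun x => f (x + s) + (-1) * f (1 * x + 0).
    by apply/funext => x; rewrite /E mul1r addr0 mulN1r.
  have sEf : smooth (fun x => (-1) * f (1 * x + 0)).
    by apply: smoothZ; exact: smooth_affine.
  move=> n; rewrite EE (derive1nD n sfs sEf).
  apply: L2D => //.
  rewrite (_ : derive1n n _ = fun x => (-1) * derive1n n f x); first exact: L2Z.
  have sf1 := @smooth_affine _ f 1 0 sf.
  elim: n => [|n IH]; first by apply/funext => x; rewrite /= mul1r addr0.
  rewrite !derive1nS IH; apply/funext => x; apply: derive1_val.
  by apply: is_deriveZ; apply: is_derive1; exact: sf.
have LE := smoothL2_L2 WE.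
have LG : L2 G by apply: L2D => //; exact: L2Z.
have FE : F = fun x => G x + a * E x.
  by apply/funext => x; rewrite /F /G /E; ring.
have E' : derive1 E = D.
  rewrite /E /D; apply/funext => x; apply: derive1_val.
  have [sf _] := Wf.
  apply: is_deriveB; last exact: smooth_is_derive.
  rewrite (_ : derive1 f (x + s) = derive1 (fun x => f (x + s)) x).
    by apply: smooth_is_derive; exact: smooth_shift.
  by rewrite derive1_shift.
(* Integration by parts gives (phi'', E) = - (phi', D) = |D|^2 / 2, and (a phi, E) = - a |E|^2 / 2.
   In the expansion of |G + a E|^2 the second term cancels a^2 |E|^2, and the first leaves a
   |D|^2. *)
have GE : dot G E = 2^-1 * dot D D - a * 2^-1 * dot E E.
  rewrite /G dotDl//; last exact: L2Z.
  rewrite integration_by_parts_L2// E' dotZl// (dot_shift_diff s L0).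
  by rewrite (dot_shift_diff s L1) -/D -/E; ring.
rewrite FE dotDD//; last exact: L2Z.
by rewrite !dotZr ?dotZl//; [rewrite GE; field|exact: L2Z].
Qed.

Lemma ae_eq0_continuous f : continuous f ->
  {ae mu, forall x, f x = 0} -> forall x, f x = 0.
Proof.
move=> cf [N [mN N0 fN]] x; apply: contrapT => /eqP fx0.
have : \forall y \near x, f y != 0.
  have : `|f y| @[y --> x] --> `|f x| by apply: cvg_norm; exact: cf.
  move=> /cvgr_gt /(_ 0); rewrite normr_gt0 => /(_ fx0).
  by apply: filterS => y; rewrite normr_gt0.
move=> /nbhs_ballP[e /= e0 xe].
pose B : set R := `]x - e, x + e[.
have mB : measurable B by exact: measurable_itv.
have : (mu B <= mu N)%E.
  apply: le_measure; rewrite ?inE//= => y; rewrite /B /=; rewrite in_itv/= => /andP[h1 h2].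
  apply: fN => /= fy0; have := xe y; rewrite /ball/= fy0 eqxx => /(_ _)/notF; apply.
  by rewrite ltr_distlC; apply/andP; split; lra.
rewrite [X in (_ <= X)%E](_ : _ = 0%E)// /B lebesgue_measure_itv/= lte_fin.
rewrite ifT; last by lra.
by rewrite -EFinB lee_fin; lra.
Qed.

Lemma continuous_dot0 f : continuous f -> L2 f -> dot f f = 0 ->
  forall x, f x = 0.
Proof.
move=> cf [mf f2] f0.
suff : {ae mu, forall x, f x = 0} by exact: ae_eq0_continuous.
have f2' : (\int[mu]_x `|(f x ^+ 2)%:E| = 0)%E.
  under eq_integral do rewrite /= ger0_norm ?sqr_ge0//.
  rewrite -EFin_Rintegral//; congr EFin; rewrite -f0.
  by apply: eq_Rintegral => x _; rewrite expr2.
have mf2 : measurable_fun [set: R] (EFin \o (fun x => f x ^+ 2)).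
  by apply/measurable_EFinP; exact: measurable_funX.
have := (ae_eq_integral_abs mu measurableT mf2).1 f2'.
apply: (@filterS _ _ (ae_filter_ringOfSetsType mu)) => x /(_ I) /= [] /eqP.
by rewrite sqrf_eq0 => /eqP.
Qed.

Lemma integrable_cst0 c : integrableR mu (fun=> c) -> c = 0.
Proof.
move=> /integrableP[_]; rewrite /= integral_cst//.
rewrite -set_itvNyy /= lebesgue_measure_itv/=.
have [->//|c0] := eqVneq c 0.
by rewrite gt0_muley// lte_fin normr_gt0.
Qed.

(** The mechanical energy w'^2 + a w^2 is both constant and integrable over the line, hence zero. *)
Lemma oscillator_L2 a w : 0 < a -> smoothL2 w ->
  (forall x, derive1 (derive1 w) x + a * w x = 0) -> forall x, w x = 0.
Proof.
move=> a0 Ww wE.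
have [sw _] := Ww; have W1 := smoothL2_deriv Ww; have [sw1 _] := W1.
pose E x := derive1 w x * derive1 w x + a * (w x * w x).
have dE x : is_derive x (1 : R) E 0.
  have d0 := smooth_is_derive x sw; have d1 := smooth_is_derive x sw1.
  have := is_deriveD (is_deriveM d1 d1) (is_deriveZ a (is_deriveM d0 d0)).
  move/is_derive_eq; apply; rewrite /GRing.scale/=.
  have := wE x; move: (derive1 (derive1 w) x) => w2 h.
  have -> : w2 = - (a * w x) by lra.
  by ring.
have Ec x : E x = E 0 by exact: is_derive_0_is_cst.
have iE : integrableR mu E.
  apply: integrableRD; first exact: L2_mul (smoothL2_L2 W1) (smoothL2_L2 W1).
  by apply: integrableRZ; exact: L2_mul (smoothL2_L2 Ww) (smoothL2_L2 Ww).
have E0 : E 0 = 0.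
  by apply: integrable_cst0; rewrite (_ : (fun=> _) = E)//; apply/funext => x; rewrite Ec.
move=> x; have := Ec x; rewrite E0 /E -!expr2 => /eqP.
rewrite paddr_eq0 ?sqr_ge0//; last by rewrite mulr_ge0 ?sqr_ge0// ltW.
move=> /andP[_].
by rewrite mulf_eq0 gt_eqF//= sqrf_eq0 => /eqP.
Qed.

(** The left side of the energy identity is 0 and its right side a sum of two nonnegative terms, so
    w'' + a w = 0: the delay disappears, for any [s]. *)
Lemma shifted_oscillator_L2 a s w : 0 < a -> smoothL2 w ->
  (forall x, derive1 (derive1 w) x + a * w (x + s) = 0) -> forall x, w x = 0.
Proof.
move=> a0 Ww wE; apply: (oscillator_L2 a0 Ww).
have W2 := smoothL2_deriv (smoothL2_deriv Ww).
apply: continuous_dot0.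
- apply: smooth_continuous; apply: smoothD; first by case: W2.
  by apply: smoothZ; case: Ww.
- by apply: L2D; [exact: smoothL2_L2|apply: L2Z; exact: smoothL2_L2].
have := energy_identity a s Ww => /=.
set A := dot _ _; set B := dot _ _; set C := dot _ _ => e.
have A0 : A = 0.
  rewrite /A (_ : (fun x => derive1 (derive1 w) x + a * w (x + s)) = fun=> 0).
    by rewrite /inner mul0r Rintegral_cst ?mul0r.
  by apply/funext => x; exact: wE.
apply/eqP; rewrite eq_le dot_ge0 andbT.
have : 0 <= a * C by rewrite mulr_ge0 ?dot_ge0 ?ltW.
by rewrite -/B; lra.
Qed.

(** Here |w|^2 = (w'', w) = - |w'|^2. *)
Lemma screened_L2 w : smoothL2 w ->
  (forall x, derive1 (derive1 w) x = w x) -> forall x, w x = 0.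
Proof.
move=> Ww wE; have W1 := smoothL2_deriv Ww.
apply: continuous_dot0; [by apply: smooth_continuous; case: Ww|exact: smoothL2_L2|].
have : dot (derive1 (derive1 w)) w = - dot (derive1 w) (derive1 w).
  exact: integration_by_parts_L2.
rewrite (_ : derive1 (derive1 w) = w); last exact/funext.
have := dot_ge0 mu w; have := dot_ge0 mu (derive1 w); lra.
Qed.

End SmoothL2.

(** * Test functions and correlations *)

Section CompactSupport.
Context {R : realType}.
Local Notation mu := (@lebesgue_measure R).
Local Notation L2 := (square_integrable mu).
Local Notation dot := (inner mu).
Implicit Types (f g r phi : R -> R) (a s c x : R).

(** Test functions with an explicit radius in place of a compact closure; [test_functionP] shows
    that the two notions agree. *)
Definition csmooth f := smooth f /\ exists K, forall x, K < `|x| -> f x = 0.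

Lemma csmooth_bound f : csmooth f ->
  exists K, 0 <= K /\ forall x, K < `|x| -> f x = 0.
Proof.
move=> [_ [K fK]]; exists (Num.max 0 K); split; first by rewrite le_max lexx.
by move=> x; rewrite gt_max => /andP[_]; exact: fK.
Qed.

Lemma test_functionP f : test_function f <-> csmooth f.
Proof.
split=> [[sf cf]|[sf]].
  split=> //; have [M [_ HM]] := compact_bounded cf.
  exists (M + 1) => x Mx; apply: contrapT => /eqP fx.
  have : `|x| <= M + 1.
    apply: HM; first by rewrite ltrDl.
    exact: subset_closure.
  by rewrite leNgt Mx.
move=> /(conj sf)/csmooth_bound[K [K0 fK]].
split=> //; apply: (subclosed_compact (@closed_closure _ _) (segment_compact (a := - K) (b := K))).
rewrite [X in _ `<=` X](@closure_id _ `[- K, K]%classic).1; last exact: itv_closed.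
apply: closure_subset => x /= /eqP fx; rewrite in_itv/= -ler_norml leNgt.
by apply/negP => /fK.
Qed.

Lemma derive1_out f K : (forall x, K < `|x| -> f x = 0) ->
  forall x, K < `|x| -> derive1 f x = 0.
Proof.
move=> fK x Kx; rewrite derive1E.
rewrite (@near_eq_derive _ _ _ f (cst 0)) ?derive_cst//.
have : `|y| @[y --> x] --> `|x| by exact: cvg_norm.
move=> /cvgr_gt /(_ K Kx); apply: filterS => y Ky; exact: fK.
Qed.

Lemma csmooth_deriv f : csmooth f -> csmooth (derive1 f).
Proof.
move=> [sf [K fK]]; split; first exact: smooth_deriv.
by exists K; exact: derive1_out.
Qed.

Lemma csmooth_bounded f : csmooth f -> exists M, 0 <= M /\ forall x, `|f x| <= M.
Proof.
move=> cf; have [K [K0 fK]] := csmooth_bound cf; have [sf _] := cf.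
have [||c _ Hc] := @EVT_max _ (fun x => `|f x|) (- K) K.
- by lra.
- apply: continuous_subspaceT => x; apply: cvg_norm; exact: smooth_continuous.
exists `|f c|; split=> // x.
have [/fK ->|xK] := ltP K `|x|; first by rewrite normr0.
by apply: Hc; rewrite in_itv/= -ler_norml.
Qed.

Lemma indic_itvE (K x : R) : (\1_(`[- K, K] : set R) x : R) = (`|x| <= K)%R%:R.
Proof. by rewrite indicE mem_setE in_itv/= -ler_norml. Qed.

Lemma L2_indic (a b : R) : L2 (\1_`[a, b]).
Proof.
split; first exact: measurable_indic.
have := @integrableR_indic R a b; congr integrable; apply/funext => x /=.
by rewrite expr2 indicE; case: (_ \in _); rewrite ?mulr1 ?mulr0.
Qed.

Lemma L2_bounded_supp f (K M : R) : measurable_fun [set: R] f ->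
  (forall x, `|f x| <= M) -> (forall x, K < `|x| -> f x = 0) -> L2 f.
Proof.
move=> mf fM fK; refine (@L2_le _ _ _ mu f _ mf (L2Z M (L2_indic (- K) K)) _) => x.
have M0 : 0 <= M by exact: le_trans (fM x).
rewrite normrM indic_itvE (ger0_norm M0).
have [/fK ->|_] := ltP K `|x|; first by rewrite normr0 mulr_ge0.
by rewrite normr1 mulr1.
Qed.

Lemma smooth_measurable f : smooth f -> measurable_fun [set: R] f.
Proof. by move=> sf; exact: (continuous_measurable_fun (smooth_continuous sf)). Qed.

Lemma csmooth_L2 f : csmooth f -> L2 f.
Proof.
move=> cf; have [K [_ fK]] := csmooth_bound cf; have [M [_ fM]] := csmooth_bounded cf.
by apply: L2_bounded_supp fM fK; apply: smooth_measurable; case: cf.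
Qed.

Lemma csmooth_derivn n f : csmooth f -> csmooth (derive1n n f).
Proof. by move=> cf; elim: n => // n IH; rewrite derive1nS; exact: csmooth_deriv. Qed.

Lemma csmooth_smoothL2 f : csmooth f -> smoothL2 f.
Proof.
by move=> cf; split; [case: cf|move=> n; exact/csmooth_L2/csmooth_derivn].
Qed.

Lemma csmoothD f g : csmooth f -> csmooth g -> csmooth (fun x => f x + g x).
Proof.
move=> [sf [K fK]] [sg [L gL]]; split; first exact: smoothD.
exists (Num.max K L) => x; rewrite gt_max => /andP[/fK -> /gL ->].
by rewrite addr0.
Qed.

Lemma csmoothMl f g : smooth f -> csmooth g -> csmooth (fun x => f x * g x).
Proof.
move=> sf [sg [L gL]]; split; first exact: smoothM.
by exists L => x /gL ->; rewrite mulr0.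
Qed.

Lemma csmoothZ c f : csmooth f -> csmooth (fun x => c * f x).
Proof. by apply: csmoothMl; exact: smooth_cst. Qed.

Lemma csmooth_affine c s f : c != 0 -> csmooth f -> csmooth (fun x => f (c * x + s)).
Proof.
move=> c0 [sf [K fK]]; split; first exact: smooth_affine.
exists ((K + `|s|) / `|c|) => x; rewrite ltr_pdivrMr ?normr_gt0// => h.
apply: fK; have := ler_normB (c * x + s) s; rewrite addrK normrM.
by rewrite mulrC => h'; lra.
Qed.

Lemma csmooth_shift s f : csmooth f -> csmooth (fun x => f (x + s)).
Proof.
by move=> /(@csmooth_affine 1 s _ (oner_neq0 _));
  under [X in csmooth X -> _]funext do rewrite mul1r.
Qed.

(** The convolution of [r] with the reflection of [phi]: a regularisation of [r] whose derivatives
    fall on [phi] and whose value at 0 is [dot r phi]. *)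
Definition corr r phi x := \int[mu]_y (r y * phi (y - x)).

Lemma corr_dot r phi x : corr r phi x = dot r (fun y => phi (y - x)).
Proof. by []. Qed.

Lemma corr_shiftE r phi x : L2 r -> L2 phi ->
  corr r phi x = \int[mu]_t (r (x + t) * phi t).
Proof.
move=> Lr Lp.
rewrite /corr -(Rintegral_shift x (L2_mul Lr (L2_shift (- x) Lp))).
by apply: eq_Rintegral => t _; rewrite addrK addrC.
Qed.

Lemma is_derive_corr r phi x : L2 r -> csmooth phi ->
  is_derive x (1 : R) (corr r phi) (corr r (fun y => - derive1 phi y) x).
Proof.
move=> Lr cp; have [sp _] := cp.
pose I : set R := `]x - 1, x + 1[.
have Ix : I x by rewrite /I /= in_itv/=; apply/andP; split; lra.
pose F z y := r y * phi (y - z).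
have cps z := csmooth_shift (- z) cp.
have iF z : I z -> mu.-integrable setT (EFin \o F z).
  by move=> _; exact: L2_mul Lr (csmooth_L2 (cps z)).
have dF z y : is_derive z (1 : R) (F ^~ y) (r y * - derive1 phi (y - z)).
  have /= h := is_derive_affine (@smooth_derivable _ phi (-1 * z + y) sp).
  have := is_deriveZ (r y) h.
  rewrite [X in is_derive _ _ X _](_ : _ = F ^~ y); last first.
    by apply/funext => t /=; rewrite /F /GRing.scale/= mulN1r addrC.
  move=> /is_derive_eq; apply; rewrite /GRing.scale/=.
  by rewrite !mulN1r addrC.
have dF' z y : I z -> setT y -> derivable (F ^~ y) z 1.
  by move=> _ _; apply: ex_derive; exact: dF.
have [M [M0 pM]] := csmooth_bounded (csmooth_deriv cp).
have [K [K0 pK]] := csmooth_bound (csmooth_deriv cp).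
(* For |z - x| <= 1 the factor [derive1 phi (y - z)] vanishes as soon as |y| > K + |x| + 1, so one
   integrable function dominates all the z-derivatives. *)
pose G y := `|r y| * (M * \1_`[- (K + (`|x| + 1)), K + (`|x| + 1)] y).
have G0 y : 0 <= G y.
  by rewrite /G mulr_ge0// mulr_ge0// indicE; case: (_ \in _).
have Lnr : L2 (fun y => `|r y|).
  refine (@L2_le _ _ _ mu (fun y => `|r y|) r _ Lr _); last by move=> y; rewrite normr_id.
  by apply: measurableT_comp => //; case: Lr.
have iG : mu.-integrable setT (EFin \o G).
  by apply: L2_mul => //; apply: L2Z; exact: L2_indic.
have GF z y : I z -> setT y -> `|partial1of2 F z y| <= G y.
  rewrite /I /= in_itv/= => /andP[z1 z2] _.
  rewrite /partial1of2 (derive1_val (dF z y)) normrM normrN /G.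
  apply: ler_wpM2l => //; rewrite indic_itvE.
  have [Ky|yK] := ltP (K + (`|x| + 1)) `|y|; last by rewrite mulr1.
  rewrite mulr0 pK ?normr0//.
  have := ler_normB (y - z) (- z); rewrite opprK subrK normrN.
  have : `|z| <= `|x| + 1.
    have := ler_normD x (z - x); rewrite addrC subrK.
    have : `|z - x| <= 1 by rewrite ler_norml; apply/andP; split; lra.
    lra.
  lra.
have D := derivable_under_integral measurableT Ix iF dF' G0 iG GF.
have E := differentiation_under_integral measurableT Ix iF dF' G0 iG GF.
have -> : corr r (fun y => - derive1 phi y) x = derive1 (corr r phi) x.
  rewrite [RHS]E; apply: eq_Rintegral => y _.
  by rewrite /partial1of2 (derive1_val (dF x y)).
by apply: is_derive1; exact: D.
Qed.

Lemma corr_smooth r phi : L2 r -> csmooth phi -> smooth (corr r phi).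
Proof.
move=> Lr cp.
apply: (@smooth_ind _ (fun f => exists2 p, csmooth p & f = corr r p)); last by exists phi.
move=> _ [p cs ->]; split.
  by move=> x; apply: ex_derive; exact: is_derive_corr.
exists (fun y => (-1) * derive1 p y); first exact/csmoothZ/csmooth_deriv.
apply/funext => x; rewrite (derive1_val (is_derive_corr x Lr cs)).
by congr corr; apply/funext => y; rewrite mulN1r.
Qed.

(** A Young inequality for kernels supported in [p, q]: Cauchy-Schwarz on the window bounds T(x)^2
    by |K|^2 times the integral of r^2 over x + [p, q], and [Rfubini_shift] integrates this in x. *)
Lemma L2_window r K (p q : R) T : p <= q -> L2 r -> L2 K ->
  (forall t, ~~ (p <= t <= q) -> K t = 0) -> measurable_fun [set: R] T ->
  (forall x, T x = \int[mu]_t (r (x + t) * K t)) ->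
  L2 T /\ dot T T <= (q - p) * dot K K * dot r r.
Proof.
move=> pq Lr LK K0 mT TE.
have [iH eH] := Rfubini_shift Lr.2 (@integrableR_indic R p q).
have iKH := integrableRZ (dot K K) iH.
have m1 : measurable_fun [set: R] (\1_(`[p, q] : set R) : R -> R).
  exact: measurable_indic.
have T2 x : T x ^+ 2 <= dot K K * \int[mu]_t (r (x + t) ^+ 2 * \1_`[p, q] t).
  pose rx t := r (x + t) * \1_`[p, q] t.
  have Lrx0 : L2 (fun t => r (x + t)).
    by have := L2_shift x Lr; congr square_integrable; apply/funext => t; rewrite addrC.
  have Lrx : L2 rx.
    refine (@L2_le _ _ _ mu rx _ _ Lrx0 _).
      by apply: measurable_funM => //; case: Lrx0.
    move=> t; rewrite /rx normrM ler_piMr// indicE.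
    by case: (_ \in _); rewrite ?normr1 ?normr0.
  have -> : T x = dot K rx.
    rewrite TE; apply: eq_Rintegral => t _; rewrite /rx indicE mem_setE in_itv/=.
    have [_|/K0 ->] := boolP (p <= t <= q); last by rewrite mulr0 mul0r.
    by rewrite mulr1 mulrC.
  apply: (le_trans (cauchy_schwarz LK Lrx)); apply: ler_wpM2l; first exact: dot_ge0.
  rewrite le_eqVlt; apply/orP; left; apply/eqP; apply: eq_Rintegral => t _.
  by rewrite /rx indicE; case: (_ \in _); rewrite ?mulr1 ?mulr0.
have iT : integrableR mu (fun x => T x ^+ 2).
  apply: (integrableR_le _ iKH); first exact: measurable_funX.
  by move=> x; rewrite ger0_norm ?sqr_ge0.
split; first by split.
rewrite [leLHS](_ : _ = \int[mu]_x (T x ^+ 2)); last first.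
  by apply: eq_Rintegral => x _; rewrite expr2.
apply: (le_trans (le_Rintegral measurableT iT iKH (fun x _ => T2 x))).
rewrite RintegralZl// eH Rintegral_indic1//.
rewrite (_ : \int[mu]_x (r x ^+ 2) = dot r r); first by rewrite mulrCA [leRHS]mulrC [(q - p) * _]mulrC.
by apply: eq_Rintegral => x _; rewrite expr2.
Qed.

Lemma corr_L2 r phi : L2 r -> csmooth phi -> L2 (corr r phi).
Proof.
move=> Lr cp; have Lp := csmooth_L2 cp; have [K [K0 pK]] := csmooth_bound cp.
have KK : - K <= K by lra.
case: (@L2_window r phi (- K) K (corr r phi) KK Lr Lp) => //.
- by move=> t; rewrite -ler_norml -ltNge => /pK.
- by apply: smooth_measurable; exact: corr_smooth.
- by move=> x; exact: corr_shiftE.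
Qed.

Lemma corr_smoothL2 r phi : L2 r -> csmooth phi -> smoothL2 (corr r phi).
Proof.
move=> Lr cp; split; first exact: corr_smooth.
suff H n : exists2 p, csmooth p & derive1n n (corr r phi) = corr r p.
  by move=> n; have [p cs ->] := H n; exact: corr_L2.
elim: n => [|n [p cs IH]]; first by exists phi.
exists (fun y => (-1) * derive1 p y); first exact/csmoothZ/csmooth_deriv.
rewrite derive1nS IH.
apply/funext => x; rewrite (derive1_val (is_derive_corr x Lr cs)).
by congr corr; apply/funext => y; rewrite mulN1r.
Qed.

Lemma derive2_corr r phi x : L2 r -> csmooth phi ->
  derive1 (derive1 (corr r phi)) x = corr r (derive1 (derive1 phi)) x.
Proof.
move=> Lr cp; have cp1 := csmooth_deriv cp.
have cp1' := csmoothZ (-1) cp1.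
rewrite (_ : derive1 (corr r phi) = corr r (fun y => (-1) * derive1 phi y)).
  rewrite (derive1_val (is_derive_corr x Lr cp1')); congr corr; apply/funext => y.
  have h : is_derive y (1 : R) (fun y => (-1) * derive1 phi y)
      ((-1) * derive1 (derive1 phi) y).
    by apply: is_deriveZ; apply: smooth_is_derive; case: cp1.
  by rewrite (derive1_val h) mulN1r opprK.
apply/funext => z; rewrite (derive1_val (is_derive_corr z Lr cp)).
by congr corr; apply/funext => y; rewrite mulN1r.
Qed.

(* The correlations of r with test functions solve the same equation
   classically, so the energy identity kills them. *)
Lemma weak_kernel a s r : 0 < a -> L2 r ->
  (forall phi, csmooth phi ->
     dot r (fun x => derive1 (derive1 phi) x + a * phi (x + s)) = 0) ->
  forall phi, csmooth phi -> dot r phi = 0.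
Proof.
move=> a0 Lr rw phi cp.
have W := corr_smoothL2 Lr cp.
have : corr r phi 0 = 0.
  (* Correlation reverses translations: shifting the test function by s shifts [corr r phi] by -
     s. *)
  apply: (@shifted_oscillator_L2 _ a (- s)) => // x.
  rewrite derive2_corr//.
  pose p y := phi (y - x).
  have cp' : csmooth p := csmooth_shift (- x) cp.
  have L2p'' := csmooth_L2 (csmooth_deriv (csmooth_deriv cp')).
  have Lps := csmooth_L2 (csmooth_shift s cp').
  have := rw _ cp'; rewrite dotDr//; last exact: L2Z.
  rewrite dotZr//.
  have -> : dot r (fun y => p (y + s)) = corr r phi (x - s).
    by apply: eq_Rintegral => y _; rewrite /p opprB addrA.
  have e2 : derive1 (derive1 p) = fun y => derive1 (derive1 phi) (y - x).
    by apply: (@derive1n_shift _ 2); case: cp.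
  by rewrite e2.
by rewrite corr_dot; congr (dot r _ = 0); apply/funext => y; rewrite subr0.
Qed.

(** The hypothesis says that u' - v is killed by d^2/dx^2 - 1 in the sense of distributions. Its
    correlations with test functions are smooth, square integrable and equal to their second
    derivative, hence zero; the value at 0 is the claim. *)
Lemma weak_kernel_screened u v : L2 u -> L2 v ->
  (forall phi, csmooth phi ->
     dot u (fun x => derive1 (derive1 (derive1 phi)) x - derive1 phi x)
     = - dot v (fun x => derive1 (derive1 phi) x - phi x)) ->
  forall phi, csmooth phi -> dot u (derive1 phi) = - dot v phi.
Proof.
move=> Lu Lv uv phi cp; have cp1 := csmooth_deriv cp.
pose w x := corr u (derive1 phi) x + corr v phi x.
have Wu := corr_smoothL2 Lu cp1; have Wv := corr_smoothL2 Lv cp.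
have Ww : smoothL2 w.
  split; first by apply: smoothD; [case: Wu|case: Wv].
  move=> n; rewrite derive1nD//; [|by case: Wu|by case: Wv].
  by apply: L2D; [case: Wu|case: Wv].
have : w 0 = 0.
  apply: (screened_L2 Ww) => x.
  have -> : derive1 (derive1 w) x =
      derive1 (derive1 (corr u (derive1 phi))) x + derive1 (derive1 (corr v phi)) x.
    have := @derive1nD _ 2 (corr u (derive1 phi)) (corr v phi) Wu.1 Wv.1.
    by move=> /(congr1 (@^~ x)).
  rewrite !derive2_corr//; apply/eqP; rewrite -subr_eq0 /w; apply/eqP.
  pose p y := phi (y - x).
  have cp' : csmooth p := csmooth_shift (- x) cp.
  have cp1' := csmooth_deriv cp'; have cp2' := csmooth_deriv cp1'.
  have Lp := csmooth_L2 cp'; have Lp1 := csmooth_L2 cp1'.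
  have Lp2 := csmooth_L2 cp2'; have Lp3 := csmooth_L2 (csmooth_deriv cp2').
  have := uv _ cp'; rewrite (dotBr Lp3 Lp1 Lu) (dotBr Lp2 Lp Lv) => e.
  have [sp _] := cp.
  have e1 : derive1 p = fun y => derive1 phi (y - x).
    exact: (@derive1n_shift _ 1).
  have e2 : derive1 (derive1 p) = fun y => derive1 (derive1 phi) (y - x).
    exact: (@derive1n_shift _ 2).
  have e3 : derive1 (derive1 (derive1 p)) = fun y => derive1 (derive1 (derive1 phi)) (y - x).
    exact: (@derive1n_shift _ 3).
  rewrite e3 e2 e1 in e.
  by rewrite opprD addrACA [X in X + _ = _]e addNr.
rewrite /w !corr_dot => /eqP; rewrite addr_eq0.
under [X in dot u X]funext do rewrite subr0.
by under [X in dot v X]funext do rewrite subr0; move/eqP.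
Qed.

End CompactSupport.

(** * Smooth bump functions *)

Section Bump.
Context {R : realType}.
Local Notation mu := (@lebesgue_measure R).
Local Notation L2 := (square_integrable mu).
Local Notation dot := (inner mu).
Implicit Types (f g r phi : R -> R) (a b c x y : R) (p : {poly R}).

Lemma poly_growth p : exists C n, 0 <= C /\
  forall y, 1 <= y -> `|p.[y]| <= C * y ^+ n.
Proof.
elim/poly_ind: p => [|p c [C [n [C0 pC]]]].
  by exists 0, 0%N; split=> // y _; rewrite horner0 normr0 mul0r.
exists (C + `|c|), n.+1; split; first by rewrite addr_ge0.
move=> y y1; have y0 : 0 <= y by lra.
rewrite hornerMXaddC (le_trans (ler_normD _ _))// mulrDl lerD//.
  rewrite normrM (ger0_norm y0) exprSr mulrA ler_wpM2r//; exact: pC.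
by rewrite ler_peMr// exprn_ege1.
Qed.

(** The exponential dominates y^(n+2) / (n+2)!, two powers beyond the growth of p. With y = 1/x this
    is the quadratic bound at 0 that [is_derive_quadratic0] asks for. *)
Lemma poly_expRN p : exists C, 0 <= C /\
  forall y, 1 <= y -> `|p.[y] * expR (- y)| <= C * y ^- 2.
Proof.
have [C [n [C0 pC]]] := poly_growth p.
exists (C * n.+2`!%:R); split; first by rewrite mulr_ge0.
move=> y y1; have y0 : 0 < y by lra.
rewrite normrM (ger0_norm (expR_ge0 _)) expRN.
have yn : 0 < y ^+ n.+2 by rewrite exprn_gt0.
have fn : (0 : R) < n.+2`!%:R by rewrite ltr0n fact_gt0.
have ey : y ^+ n.+2 / n.+2`!%:R <= expR y.
  by apply: le_trans (expR_ge1Dxn n.+1 (ltW y0)); rewrite lerDr.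
apply: (@le_trans _ _ (C * y ^+ n * (n.+2`!%:R / y ^+ n.+2))).
  apply: ler_pM; [exact: normr_ge0|by rewrite invr_ge0 expR_ge0|exact: pC|].
  rewrite -invf_div lef_pV2 ?posrE ?expR_gt0//.
  by rewrite divr_gt0.
rewrite le_eqVlt; apply/orP; left; apply/eqP.
have -> : y ^+ n.+2 = y ^+ n * y ^+ 2 by rewrite -exprD addn2.
by field; rewrite !expf_neq0 ?gt_eqF.
Qed.

Lemma is_derive_quadratic0 f C : f 0 = 0 ->
  (forall h, `|h| <= 1 -> `|f h| <= C * h ^+ 2) -> is_derive (0 : R) (1 : R) f 0.
Proof.
move=> f0 fC.
have C0 : 0 <= C.
  by have := fC 1; rewrite normr1 lexx expr1n mulr1 => /(_ isT); apply: le_trans.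
have H : h^-1 *: ((f \o shift 0) (h *: 1) - f 0) @[h --> (0 : R)^'] --> (0 : R).
  apply/cvgrPdist_lt => e e0; near=> h.
  have h0 : h != 0 by near: h; exact: nbhs_dnbhs_neq.
  have h1 : `|h| < Num.min 1 (e / (C + 1)).
    near: h; apply: dnbhs0_lt.
    by rewrite lt_min ltr01 divr_gt0// ltr_wpDl.
  rewrite sub0r normrN /= f0 subr0 addr0 /GRing.scale/= mulr1 normrM normfV.
  move: h1; rewrite lt_min => /andP[h1 he].
  rewrite mulrC ltr_pdivrMr ?normr_gt0//.
  apply: le_lt_trans (fC _ (ltW h1)) _.
  have hp : 0 < `|h| by rewrite normr_gt0.
  rewrite -(real_normK (num_real h)) expr2 mulrA ltr_pM2r//.
  move: he; rewrite ltr_pdivlMr; last lra.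
  by move=> he; nra.
split; first by apply/cvg_ex; exists 0.
exact: (cvg_lim _ H).
Unshelve. all: by end_near. Qed.

(** The polynomial makes the class of e^(-1/x) closed under differentiation: with y = 1/x, the
    derivative of p(y) e^(-y) in x is y^2 (p - p')(y) e^(-y). *)
Definition flat p x : R := if 0 < x then p.[x^-1] * expR (- x^-1) else 0.

Lemma is_derive_flat p x :
  is_derive x (1 : R) (flat p) (flat ('X^2 * (p - p^`())) x).
Proof.
have [x0|x0|<-] := ltgtP 0 x.
- have e : {near x, (fun y => p.[y^-1] * expR (- y^-1)) =1 flat p}.
    near=> y; rewrite /flat ifT//; near: y.
    exact: lt_nbhsr.
  have xn : x != 0 by rewrite gt_eqF.
  have dV : is_derive x (1 : R) (fun y : R => y^-1) (- x ^- 2).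
    have := @is_deriveV _ id x 1 1 xn (is_derive_id _ _).
    by move/is_derive_eq; apply; rewrite /GRing.scale/= mulr1.
  have dp : is_derive (x^-1) (1 : R) (fun y => p.[y]) (p^`().[x^-1])%R.
    exact: is_derive_poly.
  have d1 := @is_derive1_comp _ (fun y => p.[y]) (fun y : R => y^-1) x _ _ dp dV.
  have d2 := @is_derive1_comp _ expR (fun y : R => - y^-1) x _ _ (is_derive_expR _) (is_deriveN dV).
  have d3 := is_deriveM d1 d2.
  apply: (near_eq_is_derive e _); move: d3 => /is_derive_eq; apply.
  rewrite /flat x0 /GRing.scale/= !hornerE /=.
  by field.
- have e : {near x, cst 0 =1 flat p}.
    near=> y; rewrite /flat ifF//; apply/negbTE; rewrite -leNgt ltW//; near: y.
    exact: lt_nbhsl.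
  apply: (near_eq_is_derive e _).
  by rewrite /flat ltNge (ltW x0); exact: is_derive_cst.
- have [C [C0 pC]] := poly_expRN p.
  rewrite /flat ltxx; apply: (@is_derive_quadratic0 _ C); first by rewrite ltxx.
  move=> h; case: ifPn => [h0|_ _]; last by rewrite normr0 mulr_ge0 ?sqr_ge0.
  rewrite (ger0_norm (ltW h0)) => h1.
  have := pC h^-1; rewrite invf_ge1// => /(_ h1).
  by rewrite exprVn invrK.
Unshelve. all: by end_near. Qed.

Lemma flat_smooth p : smooth (flat p).
Proof.
apply: (@smooth_ind _ (fun f => exists p, f = flat p)); last by exists p.
move=> _ [q ->]; split; first by move=> x; apply: ex_derive; exact: is_derive_flat.
exists ('X^2 * (q - q^`()))%R; apply/funext => x.
exact: derive1_val (is_derive_flat q x).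
Qed.

(** The product of e^(-1/(x - a)) and e^(-1/(b - x)), each extended by 0. The exact zero set is what
    [cutoff_to_indic] relies on; if b <= a the function is identically 0. *)
Lemma bump_exists a b : exists f, [/\ csmooth f, (forall x, 0 <= f x < 1) &
  forall x, (f x == 0) = ~~ (a < x < b)].
Proof.
have e0 x : 0 <= flat 1 x < 1.
  rewrite /flat; case: ifP => x0; last by rewrite lexx ltr01.
  by rewrite hornerC mul1r expR_ge0 expR_lt1 oppr_lt0 invr_gt0.
have eE x : (flat 1 x == 0) = ~~ (0 < x).
  by rewrite /flat; case: ifP => x0; rewrite ?eqxx// hornerC mul1r gt_eqF// expR_gt0.
pose f x := flat 1 (1 * x + - a) * flat 1 ((-1) * x + b).
have fE x : (f x == 0) = ~~ (a < x < b).
  by rewrite /f mulf_eq0 !eE mul1r mulN1r subr_gt0 addrC subr_gt0 negb_and.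
exists f; split=> //.
- split; first by apply: smoothM; apply: smooth_affine; exact: flat_smooth.
  exists (Num.max `|a| `|b|) => x; rewrite gt_max => /andP[ax bx].
  apply/eqP; rewrite fE; apply/negP => /andP[h1 h2].
  have [x0|x0] := leP 0 x.
    by move: bx; rewrite (ger0_norm x0); have := ler_norm b; lra.
  by move: ax; rewrite (ltr0_norm x0); have := ler_norm (- a); rewrite normrN; lra.
- move=> x; rewrite /f; have /andP[h1 h2] := e0 (1 * x + - a).
  have /andP[h3 h4] := e0 ((-1) * x + b).
  rewrite mulr_ge0//=; apply: le_lt_trans (ler_piMr h1 (ltW h4)) h2.
Qed.

Lemma smooth_expn f n : smooth f -> smooth (fun x => f x ^+ n).
Proof.
move=> sf; elim: n => [|n IH]; first exact: smooth_cst.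
by under [X in smooth X]funext do rewrite exprS; exact: smoothM.
Qed.

(** With f the bump of ]a, b[, take 1 - (1 - f)^n: the power tends to 0 where f > 0, and the
    expression stays 0 elsewhere. This avoids mollifiers and plateau functions. *)
Lemma cutoff_to_indic a b : exists F : nat -> R -> R,
  [/\ forall n, csmooth (F n), forall n x, `|F n x| <= \1_(`]a, b[ : set R) x &
   forall x, F n x @[n --> \oo] --> (\1_(`]a, b[ : set R) x : R)].
Proof.
have [f [[sf [K fK]] f01 fE]] := bump_exists a b.
exists (fun n x => 1 - (1 - f x) ^+ n); split.
- move=> n; split.
    apply: smoothB; first exact: smooth_cst.
    by apply: smooth_expn; apply: smoothB; [exact: smooth_cst|exact: sf].
  by exists K => x /fK ->; rewrite subr0 expr1n subrr.
- move=> n x; have /andP[f0 f1] := f01 x.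
  rewrite indicE mem_setE in_itv/=; have := fE x.
  have [h /eqP fx|h /eqP fx] := boolP (a < x < b).
    rewrite ger0_norm; last by rewrite subr_ge0 exprn_ile1//; lra.
    by rewrite lerBlDr lerDl exprn_ge0//; lra.
  by rewrite fx subr0 expr1n subrr normr0.
- move=> x; have /andP[f0 f1] := f01 x.
  rewrite indicE mem_setE in_itv/=; have := fE x.
  have [h /eqP/eqP fx|h /eqP fx] := boolP (a < x < b).
    rewrite -[X in _ --> X](subr0 (1 : R)); apply: cvgB; first exact: cvg_cst.
    apply: cvg_expr; rewrite ger0_norm; last lra.
    by have : f x != 0 by []; rewrite neq_lt => /orP[]; lra.
  rewrite fx; under eq_cvg do rewrite subr0 expr1n subrr.
  exact: cvg_cst.
Qed.

End Bump.

(** * The fundamental lemma of the calculus of variations *)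

Section FundamentalLemma.
Context {R : realType}.
Local Notation mu := (@lebesgue_measure R).
Local Notation L2 := (square_integrable mu).
Local Notation dot := (inner mu).
Implicit Types (f g r phi : R -> R) (a b c x y : R).

Lemma Rdominated_cvg (f_ : nat -> R -> R) f g :
  (forall n, measurable_fun [set: R] (f_ n)) -> measurable_fun [set: R] f ->
  (forall x, f_ n x @[n --> \oo] --> f x) -> integrableR mu g ->
  (forall n x, `|f_ n x| <= g x) ->
  \int[mu]_x f_ n x @[n --> \oo] --> \int[mu]_x f x.
Proof.
move=> mf_ mf ff ig fg.
have mE n : measurable_fun [set: R] (EFin \o f_ n) by exact/measurable_EFinP.
have mE' : measurable_fun [set: R] (EFin \o f) by exact/measurable_EFinP.
have [||fi _ H] := @dominated_convergence _ _ _ mu setT measurableT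
  (fun n => EFin \o f_ n) (EFin \o f) (EFin \o g) mE mE' _ ig _.
- by apply: aeW => x _; apply: cvg_EFin; [exact: nearW|exact: ff].
- by apply: aeW => x n _; rewrite /= lee_fin.
apply: fine_cvg; rewrite fineK; first exact: H.
exact: integrable_fin_num.
Qed.

Lemma L2_integrable_on r (A : set R) K : L2 r -> measurable A ->
  (forall x, A x -> `|x| <= K) -> mu.-integrable A (EFin \o r).
Proof.
move=> Lr mA AK.
have mI : measurable (`[- K, K]%classic : set (measurableTypeR R)) by exact: measurable_itv.
have iK : mu.-integrable `[- K, K] (EFin \o r).
  apply: ((@integrable_mkcond _ _ _ mu _ (EFin \o r) mI).2 _).
  have := L2_mul Lr (L2_indic (- K) K); congr (mu.-integrable _ _).
  apply/funext => x; rewrite patchE /= indicE.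
  by case: ifP => _; rewrite ?mulr1 ?mulr0.
apply: (@integrableS _ _ _ mu _ A _ mI mA _ iK) => x /AK.
by rewrite /= in_itv/= -ler_norml.
Qed.

Lemma Rintegral_oo_eq0 r : L2 r -> (forall phi, csmooth phi -> dot r phi = 0) ->
  forall a b, \int[mu]_(x in `]a, b[) r x = 0.
Proof.
move=> Lr r0 a b; rewrite Rintegral_indic//.
have [F [cF F1 Fl]] := cutoff_to_indic a b.
have [mr _] := Lr.
have m1 : measurable_fun [set: R] (\1_(`]a, b[ : set R) : R -> R).
  exact: measurable_indic.
have L1 : L2 (\1_(`]a, b[ : set R)).
  refine (@L2_bounded_supp _ _ (Num.max `|a| `|b|) 1 m1 _ _) => x.
    by rewrite indicE; case: (_ \in _); rewrite ?normr1 ?normr0 ?ler01.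
  rewrite gt_max => /andP[ax bx]; rewrite indicE mem_setE in_itv/=.
  have [/andP[h1 h2]|//] := boolP (a < x < b).
  have [x0|x0] := leP 0 x.
    by move: bx; rewrite (ger0_norm x0); have := ler_norm b; lra.
  by move: ax; rewrite (ltr0_norm x0); have := ler_norm (- a); rewrite normrN; lra.
have Lar : L2 (fun x => `|r x|).
  refine (@L2_le _ _ _ mu (fun y => `|r y|) r _ Lr _); last by move=> y; rewrite normr_id.
  exact: measurableT_comp.
have : \int[mu]_x (r x * F n x) @[n --> \oo] -->
    \int[mu]_x (r x * \1_(`]a, b[ : set R) x).
  apply: (Rdominated_cvg (g := fun x => `|r x| * \1_(`]a, b[ : set R) x)).
  - by move=> n; apply: measurable_funM => //; apply: smooth_measurable; case: (cF n).
  - exact: measurable_funM.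
  - by move=> x; apply: cvgM; [exact: cvg_cst|exact: Fl].
  - exact: L2_mul.
  - by move=> n x; rewrite normrM ler_wpM2l.
rewrite (_ : (fun n => _) = fun=> 0); last by apply/funext => n; exact: r0 (cF n).
by move/cvg_unique => /(_ _ 0) <- //; exact: cvg_cst.
Qed.

(** All integrals of [r] over bounded intervals vanish, so its primitive starting at - N is 0, and
    Lebesgue differentiation gives r = 0 almost everywhere beyond - N. Countably many N cover the
    line. *)
Lemma fundamental_lemma r : L2 r -> (forall phi, csmooth phi -> dot r phi = 0) ->
  {ae mu, forall x, r x = 0}.
Proof.
move=> Lr r0; have [mr _] := Lr.
have locr : locally_integrable [set: R] r.
  split=> //; first exact: openT.
  move=> K _ cK; have [M [_ HM]] := compact_bounded cK.
  have : mu.-integrable K (EFin \o r).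
    apply: (@L2_integrable_on _ _ (M + 1)) => //; first exact: compact_measurable.
    by move=> x Kx; apply: HM => //; rewrite ltrDl.
  by move=> /integrableP[].
have rN (N : nat) : {ae mu, forall x, - N%:R < x -> r x = 0}.
  have iy y : mu.-integrable [set` Interval (BRight (- N%:R : R)) (BRight y)] (EFin \o r).
    apply: (@L2_integrable_on _ _ (N%:R + `|y|)) => // x; rewrite /= in_itv/= => /andP[h1 h2].
    have := ler_norm y; have := ler0n R N; have := normr_ge0 y => *.
    by rewrite ler_norml; apply/andP; split; lra.
  have := FTC1 iy locr.
  apply: (@filterS _ _ (ae_filter_ringOfSetsType mu)) => x h Nx.
  have Nx' : (BRight (- N%:R : R) < BRight x)%O by rewrite bnd_simp.
  have [_ <-] := h Nx'.
  rewrite (_ : (fun _ => _) = cst 0) ?derive1_cst//.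
  apply/funext => y; rewrite -Rintegral_itv_bndo_bndc; first exact: Rintegral_oo_eq0.
  apply: (integrableS _ _ _ (iy y)) => //.
  by apply: subset_itvl; rewrite bnd_simp.
have := ae_foralln rN.
apply: (@filterS _ _ (ae_filter_ringOfSetsType mu)) => x h.
have [n nx] : exists n : nat, - n%:R < x.
  exists (Num.truncn `|x|).+1; rewrite ltrNl.
  by apply: le_lt_trans (truncnS_gt _); rewrite -normrN ler_norm.
exact: h nx.
Qed.

End FundamentalLemma.

(** * Weak solutions *)

Section WeakSolutions.
Context {R : realType}.
Local Notation mu := (@lebesgue_measure R).
Local Notation L2 := (square_integrable mu).
Local Notation dot := (inner mu).
Implicit Types (f g r u v phi : R -> R) (a h b c x y : R).

Definition adj a h phi x := - derive1 (derive1 phi) x - a * phi (x + h).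

(** Both derivatives rest on the test function, so [u] need only be square integrable; its second
    derivative is recovered from the equation in [weak_H2_solution]. *)
Definition weak_solution a h f u :=
  L2 u /\ forall phi, csmooth phi -> dot u (adj a h phi) = dot f phi.

Lemma csmooth_adj a h phi : csmooth phi -> csmooth (adj a h phi).
Proof.
move=> cp.
have -> : adj a h phi = fun x => (-1) * derive1 (derive1 phi) x + (- a) * phi (x + h).
  by apply/funext => x; rewrite /adj mulN1r mulNr.
apply: csmoothD; first exact/csmoothZ/csmooth_deriv/csmooth_deriv.
by apply: csmoothZ; exact: csmooth_shift.
Qed.

Lemma weak_solution_unique a h f u w : 0 < a ->
  weak_solution a h f u -> weak_solution a h f w ->
  {ae mu, forall x, w x = u x}.
Proof.
move=> a0 [Lu uP] [Lw wP].
have Ld : L2 (fun x => w x - u x) by exact: L2B.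
suff d0 : {ae mu, forall x, w x - u x = 0}.
  by apply: (@filterS _ _ (ae_filter_ringOfSetsType mu) _ _ _ d0) => x /eqP;
    rewrite subr_eq0 => /eqP.
apply: fundamental_lemma => // phi cp.
apply: (weak_kernel a0 (s := h) Ld) => // p pc.
have Lp := csmooth_L2 (csmooth_adj a h pc).
have -> : (fun x => derive1 (derive1 p) x + a * p (x + h)) =
    fun x => (-1) * adj a h p x.
  by apply/funext => x; rewrite /adj; ring.
by rewrite dotZr// dotBl// uP// wP// subrr mulr0.
Qed.

Lemma derive1_comb p q c : smooth p -> smooth q ->
  derive1 (fun x => p x + c * q x) = fun x => derive1 p x + c * derive1 q x.
Proof.
move=> sp sq; apply/funext => x; apply: derive1_val.
by apply: is_deriveD; [exact: smooth_is_derive|apply: is_deriveZ; exact: smooth_is_derive].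
Qed.

Lemma derive2_comb p q c : smooth p -> smooth q ->
  derive1 (derive1 (fun x => p x + c * q x)) =
  fun x => derive1 (derive1 p) x + c * derive1 (derive1 q) x.
Proof.
move=> sp sq; rewrite (derive1_comb c sp sq).
exact: (derive1_comb c (smooth_deriv sp) (smooth_deriv sq)).
Qed.

Lemma csmooth_comb p q c : csmooth p -> csmooth q ->
  csmooth (fun x => p x + c * q x).
Proof. by move=> cp cq; apply: csmoothD => //; exact: csmoothZ. Qed.

Lemma csmooth0 : csmooth (fun _ : R => 0).
Proof. by split; [exact: smooth_cst|exists 0]. Qed.

Lemma riesz_test (A : (R -> R) -> R -> R) (l : (R -> R) -> R) C :
  (forall p, csmooth p -> L2 (A p)) ->
  (forall p q c, csmooth p -> csmooth q ->
    A (fun x => p x + c * q x) = fun x => A p x + c * A q x) ->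
  (forall p q c, csmooth p -> csmooth q ->
    l (fun x => p x + c * q x) = l p + c * l q) ->
  (forall p, csmooth p -> l p ^+ 2 <= C * dot (A p) (A p)) ->
  exists u, L2 u /\ forall p, csmooth p -> l p = dot u (A p).
Proof.
move=> LA AD lD lC.
apply: (@riesz_representation _ _ _ mu [the lmodType R of (R -> R^o)] csmooth A l C) => //.
- by exists (fun=> 0); exact: csmooth0.
- by move=> p q c cp cq; exact: (csmooth_comb c cp cq).
Qed.

Lemma weak_solution_exists a h f C : L2 f ->
  (forall phi, csmooth phi ->
    dot f phi ^+ 2 <= C * dot (adj a h phi) (adj a h phi)) ->
  exists u, weak_solution a h f u.
Proof.
move=> Lf fC.
have [||||u [Lu uP]] := @riesz_test (adj a h) (dot f) C.
- by move=> p cp; exact/csmooth_L2/csmooth_adj.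
- move=> p q c [sp _] [sq _]; apply/funext => x; rewrite /adj (derive2_comb c sp sq).
  by rewrite opprD mulrDr opprD addrACA [in RHS]mulrBr mulrN [a * (c * _)]mulrCA.
- move=> p q c cp cq; rewrite dotDr ?dotZr//; [exact: csmooth_L2|exact: csmooth_L2|].
  by apply: L2Z; exact: csmooth_L2.
- exact: fC.
by exists u; split=> // phi cp; rewrite -uP.
Qed.

(** The operator p'' - p is used because |p'' - p|^2 = |p''|^2 + 2 |p'|^2 + |p|^2 dominates |p'|^2.
    The functional p |-> - (v - u, p') is therefore bounded by the norm of p'' - p, as the Riesz
    theorem requires. *)
Lemma weak_first_derivative u v : L2 u -> L2 v ->
  (forall phi, csmooth phi -> dot u (derive1 (derive1 phi)) = dot v phi) ->
  exists w, L2 w /\ forall phi, csmooth phi -> dot u (derive1 phi) = - dot w phi.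
Proof.
move=> Lu Lv uv.
pose A (p : R -> R) x := derive1 (derive1 p) x - p x.
pose l p := - dot (fun x => v x - u x) (derive1 p).
have Lvu : L2 (fun x => v x - u x) by exact: L2B.
have L1 p : csmooth p -> L2 (derive1 p) by move=> cp; exact/csmooth_L2/csmooth_deriv.
have L_2 p : csmooth p -> L2 (derive1 (derive1 p)).
  by move=> cp; exact/csmooth_L2/csmooth_deriv/csmooth_deriv.
have [||||w [Lw wP]] := @riesz_test A l (dot (fun x => v x - u x) (fun x => v x - u x)).
- by move=> p cp; apply: L2B; [exact: L_2|exact: csmooth_L2].
- move=> p q c [sp _] [sq _]; apply/funext => x; rewrite /A (derive2_comb c sp sq).
  by rewrite opprD addrACA -mulrBr.
- move=> p q c cp cq; rewrite /l derive1_comb; [|by case: cp|by case: cq].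
  rewrite dotDr//; [|exact: L1|by apply: L2Z; exact: L1].
  rewrite (dotZr c (L1 _ cq) Lvu).
  by rewrite opprD mulrN.
- move=> p cp; rewrite /l sqrrN.
  apply: (le_trans (cauchy_schwarz Lvu (L1 _ cp))); apply: ler_wpM2l; first exact: dot_ge0.
  have W := csmooth_smoothL2 cp; have W1 := smoothL2_deriv W.
  have Lp := csmooth_L2 cp; have L1p := L1 _ cp; have L2p := L_2 _ cp.
  rewrite /A (dotBB L2p Lp) (integration_by_parts_L2 W1 W).
  have := dot_ge0 mu p; have := dot_ge0 mu (derive1 p).
  have := dot_ge0 mu (derive1 (derive1 p)).
  move: (dot p p) (dot (derive1 p) (derive1 p)) (dot (derive1 (derive1 p)) (derive1 (derive1 p))).
  move=> X Y Z; lra.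
exists w; split=> //; apply: weak_kernel_screened => // phi cp.
have cp1 := csmooth_deriv cp.
have L3 := L_2 _ cp1; have L1p := L1 _ cp.
rewrite (dotBr L3 L1p Lu) (uv _ cp1) -[X in _ = - X](wP _ cp) /l opprK.
by rewrite (dotBl Lv Lu L1p).
Qed.

(** The energy identity with its nonnegative delay term dropped. It holds for every [h] and serves
    in both regimes. *)
Lemma dot_adj_energy a h phi : 0 < a -> csmooth phi ->
  dot (fun x => derive1 (derive1 phi) x + a * phi x)
      (fun x => derive1 (derive1 phi) x + a * phi x)
  <= dot (adj a h phi) (adj a h phi).
Proof.
move=> a0 cp; have W := csmooth_smoothL2 cp.
have := energy_identity a h W => /= e.
have Lp := csmooth_L2 (csmooth_adj a h cp).
have E : (fun x => derive1 (derive1 phi) x + a * phi (x + h)) =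
    fun x => (-1) * adj a h phi x.
  by apply/funext => x; rewrite /adj; ring.
have LZ : L2 (fun x => (-1) * adj a h phi x) by exact: L2Z.
rewrite E (dotZl (-1) Lp LZ) (dotZr (-1) Lp Lp) in e.
have -> : dot (adj a h phi) (adj a h phi) =
    -1 * (-1 * dot (adj a h phi) (adj a h phi)) by rewrite !mulN1r opprK.
by rewrite e lerDl; apply: mulr_ge0; [exact: (ltW a0)|exact: dot_ge0].
Qed.

End WeakSolutions.

(** * Periods of the trigonometric functions and variation of constants *)

Section Trigonometry.
Context {R : realType}.
Implicit Types (x y k w : R).

Lemma trig_int_period (n : int) x :
  cos (x + 2 * pi * n%:~R) = cos x /\ sin (x + 2 * pi * n%:~R) = sin x.
Proof.
have H (m : nat) y : cos (y + 2 * pi * m%:R) = cos y /\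
    sin (y + 2 * pi * m%:R) = sin y.
  rewrite mulr_natr [2 * pi]mulr_natl.
  by rewrite (periodicn (@cosD2pi R)) (periodicn (@sinD2pi R)).
case: n => m; first exact: H.
rewrite NegzE mulrNz mulrN.
have [h1 h2] := H m.+1 (x - 2 * pi * m.+1%:R).
by split; [rewrite -h1 subrK|rewrite -h2 subrK].
Qed.

(** After reduction to y in [0, 2 pi[, injectivity of the cosine on [0, pi] applies to y or to its
    reflection 2 pi - y. *)
Lemma cos_eq1 x : cos x = 1 -> exists n : int, x = 2 * pi * n%:~R.
Proof.
move=> cx; have pi0 := pi_gt0 R.
have p0 : 0 < 2 * pi :> R by rewrite mulr_gt0.
pose n := Num.floor (x / (2 * pi)).
exists n; pose y := x - 2 * pi * n%:~R.
suff y0 : y = 0 by apply/eqP; rewrite -subr_eq0 -/y y0.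
have cy : cos y = 1.
  by rewrite -cx -[in RHS](subrK (2 * pi * n%:~R) x) (trig_int_period n _).1.
have y_ge0 : 0 <= y.
  rewrite subr_ge0 mulrC -ler_pdivlMr//; exact: floor_le_tmp.
have y_lt : y < 2 * pi.
  rewrite ltrBlDl -[X in _ + X]mulr1 -mulrDr mulrC -ltr_pdivrMr//.
  by rewrite -intrD1; exact: floorD1_gt.
have [ypi|piy] := leP y pi.
  by apply: cos_inj; rewrite ?cos0// in_itv/= ?lexx ?y_ge0// ltW.
have : 2 * pi - y = 0.
  have i1 : 2 * pi - y \in `[0, pi]%R by rewrite in_itv/=; apply/andP; split; lra.
  have i2 : (0 : R) \in `[0, pi]%R by rewrite in_itv/= lexx ltW.
  apply: (cos_inj i1 i2); rewrite cos0 -cosN opprB -[RHS]cy.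
  by have := (trig_int_period (-1) y).1; rewrite mulrNz mulr1z mulrN1.
lra.
Qed.

Lemma is_derive_sinB w k x :
  is_derive x (1 : R) (fun s => sin (w * (k - s))) (- (w * cos (w * (k - x)))).
Proof.
have dw : is_derive x (1 : R) (fun s => w * (k - s)) (- w).
  have := is_deriveZ w (is_deriveB (is_derive_cst k x (1 : R)) (is_derive_id x (1 : R))).
  by move/is_derive_eq; apply; rewrite /GRing.scale/= sub0r mulrN1.
have := @is_derive1_comp _ sin (fun s => w * (k - s)) x _ _ (is_derive_sin _) dw.
by move/is_derive_eq; apply; rewrite mulrN mulrC.
Qed.

Lemma is_derive_cosB w k x :
  is_derive x (1 : R) (fun s => cos (w * (k - s))) (w * sin (w * (k - x))).
Proof.
have dw : is_derive x (1 : R) (fun s => w * (k - s)) (- w).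
  have := is_deriveZ w (is_deriveB (is_derive_cst k x (1 : R)) (is_derive_id x (1 : R))).
  by move/is_derive_eq; apply; rewrite /GRing.scale/= sub0r mulrN1.
have := @is_derive1_comp _ cos (fun s => w * (k - s)) x _ _ (is_derive_cos _) dw.
by move/is_derive_eq; apply; rewrite mulrNN mulrC.
Qed.

Lemma smooth_sinB w k : smooth (fun s => sin (w * (k - s))).
Proof.
rewrite (_ : (fun _ => _) =
    fun s => sin (w * k) * cos (w * s) + (- cos (w * k)) * sin (w * s)).
  exact: smooth_trig.
by apply/funext => s; rewrite mulrBr sinB mulNr.
Qed.

Lemma smooth_cosB w k : smooth (fun s => cos (w * (k - s))).
Proof.
rewrite (_ : (fun _ => _) =
    fun s => cos (w * k) * cos (w * s) + sin (w * k) * sin (w * s)).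
  exact: smooth_trig.
by apply/funext => s; rewrite mulrBr cosB.
Qed.

(** [Psi s] is the position at time k of the free oscillator that has position phi(s) and velocity
    phi'(s) at time s. It would be constant for a free motion, so its derivative sees only the
    forcing phi'' + w^2 phi. *)
Lemma variation_of_constants w k phi : w != 0 -> smooth phi ->
  let Psi s := w^-1 * (sin (w * (k - s)) * derive1 phi s)
             + cos (w * (k - s)) * phi s in
  smooth Psi /\ derive1 Psi = fun s =>
    w^-1 * sin (w * (k - s)) * (derive1 (derive1 phi) s + w ^+ 2 * phi s).
Proof.
move=> w0 sp Psi; have sp1 := smooth_deriv sp; split.
  apply: smoothD; last by apply: smoothM; [exact: smooth_cosB|exact: sp].
  by apply: smoothZ; apply: smoothM; [exact: smooth_sinB|exact: sp1].
apply/funext => s; apply: derive1_val.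
have d0 := smooth_is_derive s sp; have d1 := smooth_is_derive s sp1.
have := is_deriveD (is_deriveZ w^-1 (is_deriveM (is_derive_sinB w k s) d1))
  (is_deriveM (is_derive_cosB w k s) d0).
by move/is_derive_eq; apply; rewrite /GRing.scale/=; field.
Qed.

End Trigonometry.

(** * The a priori bound away from resonance *)

Section AprioriBound.
Context {R : realType}.
Local Notation mu := (@lebesgue_measure R).
Local Notation L2 := (square_integrable mu).
Local Notation dot := (inner mu).
Implicit Types (f g r u v phi : R -> R) (a h c x y k w : R).

(** The oscillator's Green kernel, cut to a window of length k so that [L2_window] applies. *)
Definition duhamel w k (s : R) := w^-1 * sin (w * (k - s)) * \1_`[0, k] s.

Lemma duhamel_formula w k phi x : w != 0 -> 0 <= k -> smooth phi ->
  phi (x + k) - cos (w * k) * phi x - w^-1 * sin (w * k) * derive1 phi x =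
  \int[mu]_s ((derive1 (derive1 phi) (x + s) + w ^+ 2 * phi (x + s)) * duhamel w k s).
Proof.
move=> w0 k0 sp.
pose p s := phi (s + x).
have p1 : derive1 p = fun s => derive1 phi (s + x) by exact: (@derive1n_shift _ 1).
have p2 : derive1 (derive1 p) = fun s => derive1 (derive1 phi) (s + x).
  exact: (@derive1n_shift _ 2).
have sps : smooth p by exact: smooth_shift.
have [sP dP] := variation_of_constants k w0 sps.
have := ftc_smooth sP k0; rewrite dP.
rewrite Rintegral_indic; last exact: measurable_itv.
move=> e.
rewrite [RHS](_ : _ = \int[mu]_s (w^-1 * sin (w * (k - s)) *
    (derive1 (derive1 p) s + w ^+ 2 * p s) * \1_`[0, k] s)).
  by rewrite e p1 /p subrr subr0 mulr0 sin0 cos0 add0r [k + x]addrC; ring.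
apply: eq_Rintegral => s _; rewrite p2 /p /duhamel [s + x]addrC.
by rewrite mulrA; congr (_ * _); rewrite mulrC.
Qed.

Lemma duhamel_L2 w k : L2 (duhamel w k).
Proof.
have L1 := @L2_indic R 0 k.
apply: (@L2_le _ _ _ mu _ (fun x => w^-1 * \1_`[0, k] x) _ (L2Z w^-1 L1)).
  apply: measurable_funM; last exact: measurable_indic.
  apply: measurable_funM => //.
  by apply: smooth_measurable; exact: smooth_sinB.
move=> x; rewrite /duhamel !normrM ler_wpM2r// ler_piMr//; exact: sin_max.
Qed.

Lemma dot_deriv_self phi : csmooth phi -> dot phi (derive1 phi) = 0.
Proof.
move=> cp; have W := csmooth_smoothL2 cp.
have := integration_by_parts_L2 W W; rewrite dotC => e.
by move: e; set X := dot _ _; lra.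
Qed.

(** The Duhamel integral [T] contains phi(. + k) and so does [E]; in T - E it cancels, leaving (1 -
    cos (w k)) phi - sin (w k) / w phi'. These two terms are orthogonal, so the square of the first
    is at most |T - E|^2 <= 2 |T|^2 + 2 |E|^2. *)
Lemma apriori_bound_shift w k phi G E : w != 0 -> 0 <= k -> csmooth phi ->
  G = (fun x => derive1 (derive1 phi) x + w ^+ 2 * phi x) ->
  E = (fun x => phi (x + k) - phi x) ->
  (1 - cos (w * k)) ^+ 2 * dot phi phi <=
  2 * (k * dot (duhamel w k) (duhamel w k) * dot G G) + 2 * dot E E.
Proof.
move=> w0 k0 cp GE EE; have [sp _] := cp.
have cp1 := csmooth_deriv cp; have Lp := csmooth_L2 cp; have Lp1 := csmooth_L2 cp1.
have Lpk := csmooth_L2 (csmooth_shift k cp).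
have LG : L2 G.
  by rewrite GE; apply: L2D; [exact/csmooth_L2/csmooth_deriv|exact: L2Z].
have LE : L2 E by rewrite EE; exact: L2B.
pose T x := phi (x + k) - cos (w * k) * phi x - w^-1 * sin (w * k) * derive1 phi x.
have LT0 : L2 T by apply: L2B; [apply: L2B => //; exact: L2Z|exact: L2Z].
have [||_ TT] := @L2_window _ G (duhamel w k) 0 k T k0 LG (duhamel_L2 w k) _ LT0.1.
- by move=> t h; rewrite /duhamel indicE mem_setE in_itv/= (negbTE h) mulr0.
- by move=> x; rewrite /T duhamel_formula// GE.
rewrite subr0 in TT.
pose al := 1 - cos (w * k); pose be := - (w^-1 * sin (w * k)).
have LP1 := L2Z al Lp; have LP2 := L2Z be Lp1.
have e1 : (fun x => al * phi x + be * derive1 phi x) = (fun x => T x - E x).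
  by apply/funext => x; rewrite /al /be /T EE; ring.
have e2 : dot (fun x => al * phi x + be * derive1 phi x)
    (fun x => al * phi x + be * derive1 phi x) =
    al ^+ 2 * dot phi phi + be ^+ 2 * dot (derive1 phi) (derive1 phi).
  rewrite (dotDD LP1 LP2) (dotZl al Lp LP1) (dotZr al Lp Lp).
  rewrite (dotZl be Lp1 LP2) (dotZr be Lp1 Lp1) (dotZl al Lp LP2) (dotZr be Lp1 Lp).
  by rewrite dot_deriv_self// !mulr0 addr0 !mulrA -!expr2.
have e3 : dot (fun x => T x - E x) (fun x => T x - E x) <= 2 * dot T T + 2 * dot E E.
  have := dot_ge0 mu (fun x => T x + E x); rewrite (dotDD LT0 LE) (dotBB LT0 LE).
  by move: (dot T T) (dot T E) (dot E E) => X Y Z; lra.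
rewrite -e1 e2 in e3.
have h1 : 0 <= be ^+ 2 * dot (derive1 phi) (derive1 phi).
  by rewrite mulr_ge0 ?sqr_ge0 ?dot_ge0.
rewrite -/al; move: TT e3 h1.
move: (dot T T) (dot E E) (be ^+ 2 * _) (al ^+ 2 * _) (k * _ * _) => X Y Z A B; lra.
Qed.

Lemma apriori_bound a h : 0 < a ->
  (forall n : int, h != 2 * pi * n%:~R / Num.sqrt a) ->
  exists C, forall phi, csmooth phi ->
    dot phi phi <= C * dot (adj a h phi) (adj a h phi).
Proof.
move=> a0 hn; pose w := Num.sqrt a.
have w_gt0 : 0 < w by rewrite sqrtr_gt0.
have w0 : w != 0 by rewrite gt_eqF.
have w2 : w ^+ 2 = a by rewrite sqr_sqrtr// ltW.
(* Duhamel's formula runs over an interval of nonnegative length. For h < 0 the increments over h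
   and - h have the same norm, by translation ([Ek]). *)
pose k := `|h|; have k0 : 0 <= k by exact: normr_ge0.
pose al := 1 - cos (w * k).
have al0 : 0 < al ^+ 2.
  rewrite exprn_even_gt0//= subr_eq0 eq_sym; apply/eqP => /cos_eq1[n wk].
  have kn : k = 2 * pi * n%:~R / w by rewrite -wk mulrAC divff// mul1r.
  have [h0|h0] := leP 0 h.
    by have := hn n; rewrite -/w -kn /k ger0_norm// eqxx.
  have := hn (- n); rewrite -/w mulrNz mulrN mulNr -kn /k ltr0_norm// opprK.
  by rewrite eqxx.
pose B := k * dot (duhamel w k) (duhamel w k).
(* 2 B comes from the term in [G], and 8 / a^2 is twice the factor 4 / a^2 that bounds the increment
   [E h]. *)
exists ((2 * B + 8 / a ^+ 2) / al ^+ 2) => phi cp.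
pose G x := derive1 (derive1 phi) x + a * phi x.
pose F x := derive1 (derive1 phi) x + a * phi (x + h).
pose E s x := phi (x + s) - phi x.
have cp2 := csmooth_deriv (csmooth_deriv cp); have Lp2 := csmooth_L2 cp2.
have Lp := csmooth_L2 cp.
have LG : L2 G by apply: L2D => //; exact: L2Z.
have Lps s : L2 (fun x => phi (x + s)) := csmooth_L2 (csmooth_shift s cp).
have LE s : L2 (E s) by exact: L2B.
have Lad := csmooth_L2 (csmooth_adj a h cp).
have GN := dot_adj_energy h a0 cp; rewrite -/G in GN.
have FE : (fun x => a * E h x) = (fun x => (-1) * adj a h phi x - G x).
  by apply/funext => x; rewrite /adj /G /E; ring.
have LNad := L2Z (-1) Lad.
(* a E is the difference of - [adj a h phi] and [G], and the norm of [G] is at most that of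
   [adj a h phi], so |a E|^2 is at most 2 + 2 times the squared norm of the latter. *)
have EN : a ^+ 2 * dot (E h) (E h) <= 4 * dot (adj a h phi) (adj a h phi).
  rewrite (_ : a ^+ 2 * _ = dot (fun x => a * E h x) (fun x => a * E h x)); last first.
    by rewrite (dotZl a (LE h) (L2Z a (LE h))) (dotZr a (LE h) (LE h)) mulrA -expr2.
  rewrite FE (dotBB LNad LG).
  have := dot_ge0 mu (fun x => (-1) * adj a h phi x + G x); rewrite (dotDD LNad LG).
  rewrite (dotZl (-1) Lad LNad) (dotZr (-1) Lad Lad).
  move: GN; move: (dot G G) (dot (fun x => (-1) * adj a h phi x) G) => X Y.
  by move: (dot (adj a h phi) (adj a h phi)) => Z; lra.
have Ek : dot (E k) (E k) = dot (E h) (E h).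
  rewrite /k; have [h0|h0] := leP 0 h; first by rewrite ger0_norm.
  rewrite ltr0_norm// -(dot_shift (- h) (LE h) (LE h)).
  have -> : (fun x => E h (x + - h)) = (fun x => (-1) * E (- h) x).
    by apply/funext => x; rewrite /E subrK; ring.
  rewrite (dotZl (-1) (LE _) (L2Z _ (LE _))) (dotZr (-1) (LE _) (LE _)).
  by rewrite mulrA mulrNN !mul1r.
have GE : G = (fun x => derive1 (derive1 phi) x + w ^+ 2 * phi x) by rewrite w2.
have := apriori_bound_shift w0 k0 cp GE (erefl (E k)).
rewrite Ek -/al -/B => main.
rewrite mulrAC ler_pdivlMr// mulrC; apply: (le_trans main).
have B0 : 0 <= B by rewrite mulr_ge0// dot_ge0.
have h1 : B * dot G G <= B * dot (adj a h phi) (adj a h phi) by rewrite ler_wpM2l.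
have a2 : 0 < a ^+ 2 by rewrite exprn_gt0.
have h2 : dot (E h) (E h) <= 4 / a ^+ 2 * dot (adj a h phi) (adj a h phi).
  by rewrite mulrAC ler_pdivlMr// mulrC.
have -> : 8 / a ^+ 2 = 2 * (4 / a ^+ 2) by field; rewrite gt_eqF.
clear main B0; clearbody B; move: h1 h2.
move: (4 / a ^+ 2) (dot (E h) (E h)) => t X.
by move: (dot (adj a h phi) (adj a h phi)) (B * dot G G) => Z Y; lra.
Qed.

End AprioriBound.

(** * The bound at resonance under the orthogonality conditions *)

Section ResonantBound.
Context {R : realType}.
Local Notation mu := (@lebesgue_measure R).
Local Notation L2 := (square_integrable mu).
Local Notation dot := (inner mu).
Implicit Types (f g q r u v phi : R -> R) (a h c x y k w : R).

Lemma integrable_prod_mul q f : integrableR mu q -> integrableR mu f ->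
  (mu \x mu)%E.-integrable setT (EFin \o (fun z : R * R => q z.1 * f z.2)).
Proof.
move=> qi fi; have mq := integrableR_meas qi; have mf := integrableR_meas fi.
apply: integrable_prod.
  apply: measurable_funM.
    exact: (measurableT_comp mq measurable_fst).
  exact: (measurableT_comp mf measurable_snd).
move/integrableP : qi => [_ qoo]; move/integrableP : fi => [_ foo].
rewrite (_ : integral _ _ _ = (\int[mu]_x `|(q x)%:E|) * \int[mu]_y `|(f y)%:E|)%E.
  rewrite lte_mul_pinfty//; first exact: integral_ge0.
  by rewrite ge0_fin_numE// integral_ge0.
rewrite -(@ge0_integralZl _ _ _ mu _ measurableT (fun y => `|(f y)%:E|%E)); last 3 first.
- by apply/measurable_EFinP; exact: measurableT_comp.
- by move=> x _; exact: abse_ge0.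
- exact: integral_ge0.
apply: eq_integral => y _ /=.
under eq_integral do rewrite normrM EFinM.
rewrite ge0_integralZr//.
by apply/measurable_EFinP; exact: measurableT_comp.
Qed.

Lemma integrable_prod_le (p s : R * R -> R) : measurable_fun [set: R * R] s ->
  (forall z, `|s z| <= `|p z|) -> (mu \x mu)%E.-integrable setT (EFin \o p) ->
  (mu \x mu)%E.-integrable setT (EFin \o s).
Proof.
move=> ms sp ip; apply: (le_integrable measurableT _ _ ip).
  exact/measurable_EFinP.
by move=> z _ /=; rewrite lee_fin.
Qed.

(** On [- 1, 1] use |f| <= 1 + f^2, and outside it |f| <= |x f|. *)
Lemma integrable_of_moment f : L2 f -> integrableR mu (fun x => x * f x) ->
  integrableR mu f.
Proof.
move=> [mf f2] xf.
have i1 : integrableR mu (fun x => \1_`[- 1, 1] x + (f x ^+ 2 + `|x * f x|)).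
  apply: integrableRD; first exact: integrableR_indic.
  by apply: integrableRD => //; exact: (integrable_norm xf).
refine (@integrableR_le _ _ _ mu f _ mf i1 _) => x.
rewrite indic_itvE; have [x1|x1] := leP `|x| 1.
  have := normr_ge0 (x * f x); rewrite -(real_normK (num_real (f x))).
  have := sqr_ge0 (`|f x| - 2^-1); rewrite !expr2 => /=; set A := `|f x|; nra.
rewrite normrM add0r; have := sqr_ge0 (f x).
have := normr_ge0 (f x); nra.
Qed.

(** Depending on |x| only, it majorises the left tail of |f| for x <= 0 and the right tail for x >
    0. *)
Definition tail f x := \int[mu]_y (if `|x| <= `|y| then `|f y| else 0).

(** Tonelli with x integrated first: for fixed y the section |x| <= |y| has length 2 |y|, and this
    is where the first moment of f enters. *)
Lemma integrable_tail_prod f : integrableR mu f ->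
  integrableR mu (fun x => x * f x) ->
  (mu \x mu)%E.-integrable setT
    (EFin \o (fun z : R * R => if `|z.1| <= `|z.2| then `|f z.2| else 0)).
Proof.
move=> fi xfi; have mf := integrableR_meas fi.
apply: integrable_prod.
  apply: measurable_fun_ifT => //.
    apply: measurable_fun_ler; apply: measurableT_comp => //.
  by apply: measurableT_comp => //; exact: (measurableT_comp mf measurable_snd).
have -> : (\int[mu]_y \int[mu]_x
    `|(if (`|(x, y).1| <= `|(x, y).2|)%R then `|f (x, y).2|%R else 0%R)%:E|
    = \int[mu]_y `|(2 * (y * f y))%R%:E|)%E.
  apply: eq_integral => y _ /=.
  have -> : (\int[mu]_x `|(if (`|x| <= `|y|)%R then `|f y|%R else 0%R)%:E|
      = \int[mu]_x (`|f y|%:E * (\1_(`[- `|y|, `|y|]%classic : set R) x)%:E))%E.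
    apply: eq_integral => x _; rewrite indic_itvE -EFinM; congr EFin.
    by case: ifP => _; rewrite ?normr_id ?mulr1 ?mulr0 ?normr0.
  rewrite ge0_integralZl//; last first.
    by apply/measurable_EFinP; exact: measurable_indic.
  rewrite integral_indic// setIT/= lebesgue_measure_itv/= lte_fin.
  case: ltP => h.
    rewrite -EFinB -EFinM; congr EFin; rewrite !normrM [`|2|]ger0_norm//; ring.
  rewrite mule0; have := normr_ge0 y => h2.
  have -> : y = 0 by apply/eqP; rewrite -normr_le0; lra.
  by rewrite mul0r mulr0 normr0.
by have /integrableP[] := integrableRZ 2 xfi.
Qed.

(** [tail f] is integrable and bounded by the integral of |f|, so its square is integrable. *)
Lemma tail_L2 f : integrableR mu f -> integrableR mu (fun x => x * f x) ->
  L2 (tail f).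
Proof.
move=> fi xfi.
have [iT _ _] := Rfubini (integrable_tail_prod fi xfi).
have mT : measurable_fun [set: R] (tail f) by exact: integrableR_meas iT.
have fin : integrableR mu (fun y => `|f y|) by exact: (integrable_norm fi).
have mf := integrableR_meas fi.
have ti x : integrableR mu (fun y => if `|x| <= `|y| then `|f y| else 0).
  refine (@integrableR_le _ _ _ mu _ _ _ fin _); last first.
    by move=> y; case: ifP; rewrite ?normr_id// normr0.
  apply: measurable_fun_ifT => //; last exact: measurableT_comp.
  by apply: measurable_fun_ler => //; exact: measurableT_comp.
have T0 x : 0 <= tail f x by apply: Rintegral_ge0 => y _; case: ifP.
have Tf x : tail f x <= \int[mu]_y `|f y|.
  apply: le_Rintegral => //; first exact: ti.
  by move=> y _; case: ifP.
split=> //; refine (@integrableR_le _ _ _ mu _ _ _ (integrableRZ (\int[mu]_y `|f y|) iT) _).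
  exact: measurable_funX.
move=> x; rewrite ger0_norm ?sqr_ge0// expr2; apply: ler_wpM2r; first exact: T0.
exact: Tf.
Qed.

Lemma csmooth_integrable phi : csmooth phi -> integrableR mu phi.
Proof.
move=> cp; have [K [K0 pK]] := csmooth_bound cp.
have := L2_mul (csmooth_L2 cp) (L2_indic (- K) K).
congr integrableR; apply/funext => x; rewrite indic_itvE.
have [_|/pK ->] := leP `|x| K; first by rewrite mulr1.
by rewrite mul0r.
Qed.

(** Variation of constants from y to a point [M] beyond the support: [Psi] equals phi(y) at y and 0
    at [M], and the integrand vanishes past [M]. *)
Lemma fundamental_solution w phi y : w != 0 -> csmooth phi ->
  phi y = \int[mu]_x (if y < x then w^-1 * sin (w * (x - y)) *
     (derive1 (derive1 phi) x + w ^+ 2 * phi x) else 0).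
Proof.
move=> w0 cp; have [sp _] := cp; have [K [K0 pK]] := csmooth_bound cp.
have p1K := derive1_out pK; have p2K := derive1_out p1K.
pose M := K + `|y| + 1.
have yM : y <= M by have := ler_norm y; rewrite /M; lra.
have KM : K < `|M| by rewrite ger0_norm /M; have := normr_ge0 y; lra.
have [sP dP] := variation_of_constants y w0 sp.
have := ftc_smooth sP yM; rewrite dP Rintegral_indic; last exact: measurable_itv.
rewrite subrr mulr0 sin0 cos0 !mul0r mulr0 add0r mul1r pK// p1K// !mulr0 addr0 sub0r.
move=> /(congr1 -%R); rewrite opprK => <-.
rewrite -mulN1r -RintegralZl//; last first.
  apply: L2_mul; last exact: L2_indic.
  have cG : csmooth (fun x => derive1 (derive1 phi) x + w ^+ 2 * phi x).
    by apply: csmoothD; [exact/csmooth_deriv/csmooth_deriv|exact: csmoothZ].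
  apply: csmooth_L2; apply: (csmoothMl _ cG).
  by apply: smoothZ; exact: smooth_sinB.
apply: eq_Rintegral => x _; rewrite indicE mem_setE in_itv/=.
case: ifP => [yx|/negbT yx].
  have -> : sin (w * (x - y)) = - sin (w * (y - x)).
    by rewrite -sinN -mulrN opprB.
  rewrite (ltW yx)/=; have [xM|Mx] := leP x M; first by rewrite mulr1; ring.
  have Kx : K < `|x|.
    by rewrite ger0_norm; have := normr_ge0 y; move: Mx; rewrite /M; lra.
  by rewrite pK// p2K// !mulr0 addr0 !mulr0.
rewrite -leNgt in yx; case: andP => [[yx' _]|_]; last by rewrite !mulr0.
have -> : x = y by apply/eqP; rewrite eq_le yx.
by rewrite subrr mulr0 sin0 mulr0 !mul0r mulr0.
Qed.

(* Without the orthogonality conditions the particular solution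
   \int_(y < x) sin (w (x - y)) / w * f y dy oscillates at +oo; with them it
   equals minus the integral over (y >= x), hence is dominated by [tail f]. *)
Lemma resonant_kernel_bound w f q x : w != 0 -> integrableR mu f ->
  \int[mu]_y (f y * cos (w * y)) = 0 -> \int[mu]_y (f y * sin (w * y)) = 0 ->
  `|\int[mu]_y (if y < x then w^-1 * sin (w * (x - y)) * q x * f y else 0)|
  <= `|w^-1| * (`|q x| * tail f x).
Proof.
move=> w0 fi fc fs; have mf := integrableR_meas fi.
pose s y := w^-1 * sin (w * (x - y)) * q x * f y.
have ms : measurable_fun [set: R] s.
  apply: measurable_funM => //; apply: measurable_funM => //; apply: measurable_funM => //.
  by apply: smooth_measurable; exact: smooth_sinB.
have fin : integrableR mu (fun y => `|f y|) by exact: (integrable_norm fi).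
have sb y : `|s y| <= `|w^-1| * `|q x| * `|f y|.
  rewrite /s !normrM ler_wpM2r// ler_wpM2r// ler_piMr//; exact: sin_max.
have ifin := integrableRZ (`|w^-1| * `|q x|) fin.
have si : integrableR mu s by exact: (@integrableR_le _ _ _ mu _ _ ms ifin).
have mlt : measurable_fun [set: R] (fun y => y < x) by exact: measurable_fun_ltr.
have i1 : integrableR mu (fun y => if y < x then s y else 0).
  refine (@integrableR_le _ _ _ mu _ _ _ ifin _).
    exact: measurable_fun_ifT.
  by move=> y; case: ifP => // _; rewrite normr0 mulr_ge0// mulr_ge0.
have i2 : integrableR mu (fun y => if y < x then 0 else s y).
  refine (@integrableR_le _ _ _ mu _ _ _ ifin _).
    exact: measurable_fun_ifT.
  by move=> y; case: ifP => // _; rewrite normr0 mulr_ge0// mulr_ge0.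
have it : integrableR mu (fun y => if `|x| <= `|y| then `|f y| else 0).
  refine (@integrableR_le _ _ _ mu _ _ _ fin _); last first.
    by move=> y; case: ifP; rewrite ?normr_id// normr0.
  apply: measurable_fun_ifT => //; last exact: measurableT_comp.
  by apply: measurable_fun_ler => //; exact: measurableT_comp.
(* By the addition formula for the sine, this is a combination of the two vanishing integrals with
   coefficients depending on x. *)
have s0 : \int[mu]_y s y = 0.
  have ic : integrableR mu (fun y => f y * cos (w * y)).
    refine (@integrableR_le _ _ _ mu _ _ _ fin _).
      apply: measurable_funM => //; apply: smooth_measurable.
      have := @smooth_cosB R w 0; under [X in smooth X -> _]funext do
        rewrite sub0r mulrN cosN; exact.
    by move=> y; rewrite normrM ler_piMr//; exact: cos_max.
  have is_ : integrableR mu (fun y => f y * sin (w * y)).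
    refine (@integrableR_le _ _ _ mu _ _ _ fin _).
      apply: measurable_funM => //; apply: smooth_measurable.
      have := @smooth_trig R 0 1 w; under [X in smooth X -> _]funext do
        rewrite mul0r add0r mul1r; exact.
    by move=> y; rewrite normrM ler_piMr//; exact: sin_max.
  have -> : \int[mu]_y s y = \int[mu]_y (
      w^-1 * q x * sin (w * x) * (f y * cos (w * y)) +
      - (w^-1 * q x * cos (w * x)) * (f y * sin (w * y))).
    apply: eq_Rintegral => y _; rewrite /s mulrBr sinB; ring.
  rewrite RintegralD//; [|exact: integrableRZ|exact: integrableRZ].
  by rewrite !RintegralZl// fc fs !mulr0 addr0.
have B (g : R -> R) : integrableR mu g ->
    (forall y, `|g y| <= `|w^-1| * `|q x| * (if `|x| <= `|y| then `|f y| else 0)) ->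
    `|\int[mu]_y g y| <= `|w^-1| * (`|q x| * tail f x).
  move=> gi gb; apply: (le_trans (le_normr_Rintegral measurableT gi)).
  rewrite mulrA /tail -RintegralZl//.
  apply: le_Rintegral => //; first exact: (integrable_norm gi).
  exact: integrableRZ.
(* For x <= 0 the region y < x already lies in |x| <= |y|. For x > 0 it does not, and [s0] trades it
   for the region y >= x, up to sign. *)
have [x0|x0] := leP x 0.
  apply: B => // y; case: ifP => yx; last first.
    by rewrite normr0 mulr_ge0 ?mulr_ge0//; case: ifP.
  rewrite ifT; first exact: sb.
  by rewrite !ler0_norm; lra.
have e : \int[mu]_y (if y < x then s y else 0) +
    \int[mu]_y (if y < x then 0 else s y) = 0.
  rewrite -RintegralD// -[RHS]s0; apply: eq_Rintegral => y _.
  by case: ifP => _; rewrite ?addr0 ?add0r.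
move: e => /eqP; rewrite addr_eq0 => /eqP ->; rewrite normrN.
apply: B => // y; case: ifP => yx.
  by rewrite normr0 mulr_ge0 ?mulr_ge0//; case: ifP.
rewrite ifT; first exact: sb.
by move/negbT: yx; rewrite -leNgt => yx; rewrite !ger0_norm; lra.
Qed.

Lemma resonant_bound w f : w != 0 -> L2 f ->
  integrableR mu (fun x => x * f x) ->
  \int[mu]_y (f y * cos (w * y)) = 0 -> \int[mu]_y (f y * sin (w * y)) = 0 ->
  exists C, forall phi G, csmooth phi ->
    G = (fun x => derive1 (derive1 phi) x + w ^+ 2 * phi x) ->
    dot f phi ^+ 2 <= C * dot G G.
Proof.
move=> w0 Lf xfi fc fs.
have fi := integrable_of_moment Lf xfi; have mf := integrableR_meas fi.
have LT := tail_L2 fi xfi.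
exists (w^-1 ^+ 2 * dot (tail f) (tail f)) => phi G cp GE.
have cG : csmooth G.
  by rewrite GE; apply: csmoothD; [exact/csmooth_deriv/csmooth_deriv|exact: csmoothZ].
have LG := csmooth_L2 cG; have iG := csmooth_integrable cG.
have mG := integrableR_meas iG.
have iker y : integrableR mu (fun x => if y < x then w^-1 * sin (w * (x - y)) *
    (derive1 (derive1 phi) x + w ^+ 2 * phi x) else 0).
  refine (@integrableR_le _ _ _ mu _ _ _ (integrable_norm (integrableRZ w^-1 iG)) _).
    apply: measurable_fun_ifT; [exact: measurable_fun_ltr| |exact: measurable_cst].
    apply: measurable_funM; last by rewrite -GE.
    apply: measurable_funM; first exact: measurable_cst.
    have := @smooth_sinB R (- w) y => /smooth_measurable.
    by under [X in measurable_fun _ X -> _]funext do rewrite mulNr -mulrN opprB.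
  move=> x; case: ifP => _ /=; last by rewrite normr0.
  rewrite GE !normrM; apply: ler_wpM2r; first exact: normr_ge0.
  by apply: ler_piMr; [exact: normr_ge0|exact: sin_max].
pose s (z : R * R) := if z.2 < z.1 then w^-1 * sin (w * (z.1 - z.2)) * G z.1 * f z.2 else 0.
have mG1 : measurable_fun [set: R * R] (fun z : R * R => G z.1).
  exact: (measurableT_comp mG measurable_fst).
have mf2 : measurable_fun [set: R * R] (fun z : R * R => f z.2).
  exact: (measurableT_comp mf measurable_snd).
have ms : measurable_fun [set: R * R] s.
  apply: measurable_fun_ifT => //; first exact: measurable_fun_ltr.
  apply: measurable_funM => //; apply: measurable_funM => //; apply: measurable_funM => //.
  have msin : measurable_fun [set: R] (fun t => sin (w * (0 - t))).
    by apply: smooth_measurable; exact: smooth_sinB.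
  have mB : measurable_fun [set: R * R] (fun z : R * R => z.2 - z.1 : R).
    exact: measurable_funB.
  rewrite (_ : (fun _ => _) = (fun t => sin (w * (0 - t))) \o (fun z : R * R => z.2 - z.1)).
    exact: (measurableT_comp msin mB).
  by apply/funext => z /=; rewrite sub0r opprB.
have is_ : (mu \x mu)%E.-integrable setT (EFin \o s).
  apply: (integrable_prod_le ms _ (integrable_prod_mul (integrableRZ w^-1 iG) fi)).
  move=> z; rewrite /s; case: ifP => _; last by rewrite normr0.
  rewrite !normrM ler_wpM2r// ler_wpM2r// ler_piMr//; exact: sin_max.
have [iI _ eI] := Rfubini is_.
(* [fundamental_solution] replaces phi(y), and the order of integration is exchanged so that the
   inner integral is the one over y < x controlled by [resonant_kernel_bound]. *)
have fE : dot f phi = \int[mu]_x \int[mu]_y s (x, y).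
  rewrite eI; apply: eq_Rintegral => y _.
  rewrite (fundamental_solution y w0 cp) -RintegralZl; last 2 first.
  - exact: measurableT.
  - exact: iker.
  apply: eq_Rintegral => x _; rewrite /s/= GE; case: ifP => _; last by rewrite mulr0.
  by rewrite mulrC.
have LaG : L2 (fun x => `|G x|).
  refine (@L2_le _ _ _ mu _ G _ LG _); last by move=> y; rewrite normr_id.
  exact: measurableT_comp.
have h1 : `|dot f phi| <= `|w^-1| * dot (fun x => `|G x|) (tail f).
  rewrite fE; apply: (le_trans (le_normr_Rintegral measurableT iI)).
  have iGT := L2_mul LaG LT.
  rewrite /inner -RintegralZl; last 2 first.
  - exact: measurableT.
  - exact: iGT.
  apply: (le_Rintegral measurableT (integrable_norm iI) (integrableRZ _ iGT)) => x _.
  exact: resonant_kernel_bound.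
have h2 := cauchy_schwarz LaG LT.
have h3 : dot (fun x => `|G x|) (fun x => `|G x|) = dot G G.
  by apply: eq_Rintegral => x _; rewrite -!expr2 real_normK ?num_real.
clear - h1 h2 h3; rewrite -(real_normK (num_real (dot f phi))).
apply: (@le_trans _ _ ((`|w^-1| * dot (fun x => `|G x|) (tail f)) ^+ 2)).
  by rewrite ler_sqr ?nnegrE//; exact: le_trans h1.
rewrite exprMn real_normK ?num_real// -[leRHS]mulrA; apply: ler_wpM2l.
  exact: sqr_ge0.
by rewrite [leRHS]mulrC -h3.
Qed.

End ResonantBound.

(** * Necessity of the orthogonality conditions *)

Section Necessity.
Context {R : realType}.
Local Notation mu := (@lebesgue_measure R).
Local Notation L2 := (square_integrable mu).
Local Notation dot := (inner mu).
Implicit Types (f g q r u v phi chi c : R -> R) (a h x y k w e : R).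

Lemma smooth_lipschitz f (M : R) : smooth f -> (forall x, `|derive1 f x| <= M) ->
  forall x y, `|f x - f y| <= M * `|x - y|.
Proof.
move=> sf fM; have H x y : x <= y -> `|f x - f y| <= M * `|x - y|.
  move=> xy; have [||z _ e] := @MVT_segment _ f (derive1 f) x y xy.
  - by move=> z _; exact: smooth_is_derive.
  - by apply: continuous_subspaceT; exact: smooth_continuous.
  by rewrite distrC e normrM [`|x - y|]distrC ler_wpM2r.
move=> x y; have [/H//|/ltW/H] := leP x y.
by rewrite distrC [`|y - x|]distrC.
Qed.

(** Since c'' = - a c and c is h-periodic, the terms without a derivative of the cutoff combine into
    an increment of the cutoff; every remaining term is O(e). *)
Lemma adj_cutoff a h chi c e : smooth chi -> smooth c ->
  (forall x, derive1 (derive1 c) x = - (a * c x)) ->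
  (forall x, c (x + h) = c x) ->
  adj a h (fun x => chi (e * x + 0) * c x) = fun x =>
    - (e ^+ 2 * derive1 (derive1 chi) (e * x + 0) * c x
       + 2 * e * derive1 chi (e * x + 0) * derive1 c x)
    + a * (chi (e * x + 0) - chi (e * (x + h) + 0)) * c x.
Proof.
move=> sh sc c2 ch.
have sh1 := smooth_deriv sh; have sc1 := smooth_deriv sc.
have d1 : derive1 (fun x => chi (e * x + 0) * c x) = fun x =>
    chi (e * x + 0) * derive1 c x + e * derive1 chi (e * x + 0) * c x.
  rewrite deriv1M; [|by move=> x; apply: smooth_derivable; exact: smooth_affine
                    |by move=> x; exact: smooth_derivable].
  by have := derive1n_affine 1 e 0 sh; rewrite /= expr1 => ->.
have d2 : derive1 (derive1 (fun x => chi (e * x + 0) * c x)) = fun x =>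
    e ^+ 2 * derive1 (derive1 chi) (e * x + 0) * c x
       + 2 * e * derive1 chi (e * x + 0) * derive1 c x
       + chi (e * x + 0) * derive1 (derive1 c) x.
  rewrite d1; apply/funext => x; apply: derive1_val.
  have h0 := is_derive_affine (@smooth_derivable _ chi (e * x + 0) sh).
  have h1 := is_derive_affine (@smooth_derivable _ _ (e * x + 0) sh1).
  have k0 := smooth_is_derive x sc; have k1 := smooth_is_derive x sc1.
  have := is_deriveD (is_deriveM h0 k1) (is_deriveM (is_deriveZ e h1) k0).
  move/is_derive_eq; apply; rewrite /= /GRing.scale/=.
  move: (derive1 (derive1 chi) (e * x + 0)) (derive1 chi (e * x + 0)).
  move: (derive1 (derive1 c) x) (derive1 c x) (chi (e * x + 0)) (c x).
  by move=> r1 r2 r3 r4 r5 r6; ring.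
apply/funext => x; rewrite /adj d2 c2 ch; ring.
Qed.

(** (f, phi_n) = (u, adj phi_n) tends to 0 by Cauchy-Schwarz, because [adj] maps the cutoff phi_n to
    a function of squared norm O(e_n). By dominated convergence it also tends to chi(0) times the
    integral of f c. *)
Lemma resonant_necessary a h f u c (M : R) : 0 < a -> L2 f -> integrableR mu f ->
  smooth c -> (forall x, derive1 (derive1 c) x = - (a * c x)) ->
  (forall x, c (x + h) = c x) ->
  (forall x, `|c x| <= M) -> (forall x, `|derive1 c x| <= M) ->
  weak_solution a h f u -> \int[mu]_x (f x * c x) = 0.
Proof.
move=> a0 Lf fi sc c2 ch cM c1M [Lu uP].
have mf := integrableR_meas fi.
have [chi [cchi chi01 chiE]] := @bump_exists R (- 1) 1.
have [sh _] := cchi; have sh1 := smooth_deriv sh.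
have hK x : 1 < `|x| -> chi x = 0.
  move=> x1; apply/eqP; rewrite chiE -ltr_norml -leNgt; exact: ltW.
have h1K := derive1_out hK; have h2K := derive1_out h1K.
have [M1 [M10 h1M]] := csmooth_bounded (csmooth_deriv cchi).
have [M2 [M20 h2M]] := csmooth_bounded (csmooth_deriv (csmooth_deriv cchi)).
have M0 : 0 <= M by exact: le_trans (cM 0).
pose e n : R := n.+1%:R^-1.
have e0 n : 0 < e n by rewrite invr_gt0.
have e1 n : e n <= 1 by rewrite invf_le1// ler1n.
pose phi n x := chi (e n * x + 0) * c x.
have cphi n : csmooth (phi n).
  have := csmoothMl sc (@csmooth_affine _ (e n) 0 _ (lt0r_neq0 (e0 n)) cchi).
  by congr csmooth; apply/funext => x; rewrite mulrC.
(* One summand for each term of [adj_cutoff]: chi'' c, where e^2 <= e is used, then chi' c', then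
   the increment of chi over e h, bounded by the Lipschitz constant [M1]. *)
pose B := M2 * M + 2 * M1 * M + a * M1 * `|h| * M.
have B0 : 0 <= B by rewrite !addr_ge0// !mulr_ge0// ltW.
(* Beyond this radius both e x and e (x + h) lie outside the support of chi. *)
pose L n := n.+1%:R + `|h|.
have adjb n x : `|adj a h (phi n) x| <= e n * B * \1_(`[- L n, L n] : set R) x.
  rewrite adj_cutoff// indic_itvE.
  have [xL|Lx] := leP `|x| (L n); last first.
    have ex : 1 < `|e n * x + 0|.
      rewrite addr0 normrM (gtr0_norm (e0 n)) mulrC -ltr_pdivrMr// div1r invrK.
      by apply: le_lt_trans Lx; rewrite lerDl.
    have exh : 1 < `|e n * (x + h) + 0|.
      rewrite addr0 normrM (gtr0_norm (e0 n)) mulrC -ltr_pdivrMr// div1r invrK.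
      have := ler_normB (x + h) h; rewrite addrK; move: Lx; rewrite /L; lra.
    by rewrite (hK _ ex) (hK _ exh) (h1K _ ex) (h2K _ ex) !(mulr0, mul0r, addr0, subrr, oppr0, normr0).
  rewrite mulr1 /B.
  apply: (le_trans (ler_normD _ _)); rewrite normrN.
  apply: (le_trans (lerD (ler_normD _ _) (lexx _))).
  rewrite !normrM (gtr0_norm (e0 n)) (gtr0_norm a0) [`|2|]ger0_norm//.
  have t1 : e n * e n * `|derive1 (derive1 chi) (e n * x + 0)| * `|c x| <=
      e n * (M2 * M).
    rewrite -!mulrA ler_pM2l// -[leRHS]mul1r.
    by apply: ler_pM; [exact: ltW|exact: mulr_ge0|exact: e1|exact: ler_pM].
  have t2 : 2 * e n * `|derive1 chi (e n * x + 0)| * `|derive1 c x| <=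
      e n * (2 * M1 * M).
    by rewrite -!mulrA mulrCA ler_pM2l// ler_pM2l//; exact: ler_pM.
  have t3 : a * `|chi (e n * x + 0) - chi (e n * (x + h) + 0)| * `|c x| <=
      e n * (a * M1 * `|h| * M).
    have lip : `|chi (e n * x + 0) - chi (e n * (x + h) + 0)| <= e n * (M1 * `|h|).
      apply: le_trans (smooth_lipschitz sh h1M _ _) _.
      rewrite !addr0 -mulrBr opprD addrA subrr sub0r normrM normrN (gtr0_norm (e0 n)).
      by rewrite mulrCA.
    have -> : e n * (a * M1 * `|h| * M) = a * (e n * (M1 * `|h|)) * M by ring.
    apply: ler_pM => //; first exact: mulr_ge0 (ltW a0) (normr_ge0 _).
    by rewrite ler_pM2l.
  by rewrite [leRHS]mulrDr [X in _ <= X + _]mulrDr; apply: lerD => //; exact: lerD.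
have adjN n : dot (adj a h (phi n)) (adj a h (phi n)) <=
    2 * B ^+ 2 * (1 + `|h|) * e n.
  have L0 : 0 <= L n by rewrite addr_ge0.
  have LL : - L n <= L n by apply: (le_trans _ L0); rewrite oppr_le0.
  have i1 := integrableRZ ((e n * B) ^+ 2) (@integrableR_indic R (- L n) (L n)).
  have La := csmooth_L2 (csmooth_adj a h (cphi n)).
  apply: (@le_trans _ _ (\int[mu]_x ((e n * B) ^+ 2 * \1_(`[- L n, L n] : set R) x))).
    apply: le_Rintegral => //; first exact: L2_mul.
    move=> x _; rewrite -expr2 -(real_normK (num_real _)).
    apply: (@le_trans _ _ ((e n * B * \1_(`[- L n, L n] : set R) x) ^+ 2)).
      by rewrite ler_sqr ?nnegrE//; exact: le_trans (adjb n x).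
    rewrite exprMn indicE; case: (_ \in _) => //=; first by rewrite expr1n.
    by rewrite expr0n.
  rewrite RintegralZl//; last exact: integrableR_indic.
  rewrite Rintegral_indic1//.
  have en : e n * n.+1%:R = 1 by rewrite mulVf.
  have -> : (e n * B) ^+ 2 * (L n - - L n) =
      2 * B ^+ 2 * e n * (e n * n.+1%:R + e n * `|h|) by rewrite /L; ring.
  rewrite en mulrAC ler_wpM2r ?(ltW (e0 n))//.
  apply: ler_wpM2l; first by rewrite mulr_ge0// sqr_ge0.
  by rewrite lerD2l ler_piMl.
have lim1 : dot f (phi n) @[n --> \oo] --> \int[mu]_x (f x * (chi 0 * c x)).
  apply: (Rdominated_cvg (g := fun x => M * `|f x|)).
  - by move=> n; apply: measurable_funM => //; apply: smooth_measurable; case: (cphi n).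
  - by apply: measurable_funM => //; apply: smooth_measurable; exact: smoothZ.
  - move=> x; apply: cvgM; first exact: cvg_cst.
    apply: cvgM; last exact: cvg_cst.
    have l0 : e n * x + 0 @[n --> \oo] --> (0 : R).
      have : e n * x @[n --> \oo] --> 0 * x.
        by apply: cvgM; [exact: cvg_harmonic|exact: cvg_cst].
      by rewrite mul0r; under [X in _ -> X]eq_cvg do rewrite addr0.
    exact: (cvg_comp _ _ l0 (@smooth_continuous _ chi sh 0)).
  - by apply: integrableRZ; exact: (integrable_norm fi).
  - move=> n x; rewrite normrM mulrC ler_wpM2r// /phi normrM.
    have /andP[c0 c1] := chi01 (e n * x + 0).
    rewrite (ger0_norm c0) -[leRHS]mul1r; apply: ler_pM => //; exact: ltW.
have e2 : \int[mu]_x (f x * (chi 0 * c x)) = chi 0 * \int[mu]_x (f x * c x).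
  rewrite -RintegralZl//; first by apply: eq_Rintegral => x _; rewrite mulrCA.
  refine (@integrableR_le _ _ _ mu _ _ _ (integrableRZ M (integrable_norm fi)) _).
    by apply: measurable_funM => //; exact: smooth_measurable.
  by move=> x; rewrite normrM mulrC ler_wpM2r.
rewrite e2 in lim1.
(* The bump takes values below 1, so chi(0) is not normalised; that it is nonzero is enough. *)
have c00 : chi 0 != 0 by rewrite chiE negbK; apply/andP; split; lra.
suff : (chi 0 * \int[mu]_x (f x * c x)) ^+ 2 <= 0.
  move=> h0; have : (chi 0 * \int[mu]_x (f x * c x)) ^+ 2 == 0.
    by rewrite eq_le h0 sqr_ge0.
  by rewrite sqrf_eq0 mulf_eq0 (negbTE c00)/= => /eqP.
pose C := dot u u * (2 * B ^+ 2 * (1 + `|h|)).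
have sq n : dot f (phi n) ^+ 2 <= C * e n.
  rewrite -uP//; apply: (le_trans (cauchy_schwarz Lu _)).
    exact/csmooth_L2/csmooth_adj.
  by rewrite /C -mulrA ler_wpM2l ?dot_ge0.
have lim2 : dot f (phi n) ^+ 2 @[n --> \oo] --> (chi 0 * \int[mu]_x (f x * c x)) ^+ 2.
  by under eq_cvg do rewrite expr2; rewrite expr2; exact: (cvgM lim1 lim1).
have lim3 : C * e n @[n --> \oo] --> 0.
  have : C * e n @[n --> \oo] --> C * 0.
    by apply: cvgM; [exact: cvg_cst|exact: cvg_harmonic].
  by rewrite mulr0.
apply: (ler_cvg_to lim2 lim3); exact: nearW.
Qed.

Lemma resonant_orthogonality w h f u (n : int) (A B : R) :
  0 < w -> h = 2 * pi * n%:~R / w -> L2 f -> integrableR mu f ->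
  weak_solution (w ^+ 2) h f u ->
  \int[mu]_x (f x * (A * cos (w * x) + B * sin (w * x))) = 0.
Proof.
move=> w0 hE Lf fi Wu.
have cb C D x : `|C * cos (w * x) + D * sin (w * x)| <= `|C| + `|D|.
  apply: (le_trans (ler_normD _ _)); rewrite !normrM.
  by apply: lerD; apply: ler_piMr => //; [exact: cos_max|exact: sin_max].
(* The factor 1 + w lets one constant bound both the function and its derivative. *)
apply: (@resonant_necessary (w ^+ 2) h f u
  (fun x => A * cos (w * x) + B * sin (w * x)) ((`|A| + `|B|) * (1 + w))) => //.
- by rewrite exprn_gt0.
- exact: smooth_trig.
- by move=> x; rewrite derive1_trig derive1_trig; ring.
- move=> x; have -> : w * (x + h) = w * x + 2 * pi * n%:~R.
    by rewrite mulrDr hE [in X in _ + X]mulrC divfK// gt_eqF.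
  by have [-> ->] := trig_int_period n (w * x).
- move=> x; apply: (le_trans (cb _ _ _)).
  by rewrite ler_peMr// ?addr_ge0// lerDl ltW.
- move=> x; rewrite derive1_trig; apply: (le_trans (cb _ _ _)).
  rewrite !normrM normrN (gtr0_norm w0) -mulrDl addrC ler_wpM2l ?addr_ge0//.
  by rewrite lerDr.
Qed.

End Necessity.

(** * Complex-valued solutions *)

Local Open Scope complex_scope.

Section ComplexValued.
Context {R : realType}.
Local Notation mu := (@lebesgue_measure R).
Local Notation L2 := (square_integrable mu).
Local Notation dot := (inner mu).
Local Notation Re := complex.Re.
Local Notation Im := complex.Im.
Implicit Types (f u v w : R -> R[i]) (phi : R -> R) (a h x : R).

Lemma normc_sqr (z : R[i]) : ComplexField.Normc.normc z ^+ 2 = Re z ^+ 2 + Im z ^+ 2.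
Proof. by case: z => a b /=; rewrite sqr_sqrtr// addr_ge0// sqr_ge0. Qed.

Lemma normc_ge0 (z : R[i]) : 0 <= ComplexField.Normc.normc z.
Proof. by case: z => a b /=; exact: sqrtr_ge0. Qed.

Lemma Re_le_normc (z : R[i]) : `|Re z| <= ComplexField.Normc.normc z.
Proof.
rewrite -ler_sqr ?nnegrE ?normc_ge0// normc_sqr real_normK ?num_real//.
by rewrite lerDl sqr_ge0.
Qed.

Lemma Im_le_normc (z : R[i]) : `|Im z| <= ComplexField.Normc.normc z.
Proof.
rewrite -ler_sqr ?nnegrE ?normc_ge0// normc_sqr real_normK ?num_real//.
by rewrite lerDr sqr_ge0.
Qed.

Lemma cLp2P f : cLp 2%:E f <-> L2 (fun x => Re (f x)) /\ L2 (fun x => Im (f x)).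
Proof.
have E : (\int[mu]_x (`|(ComplexField.Normc.normc (f x))%:E| `^ 2) =
    \int[mu]_x (Re (f x) ^+ 2 + Im (f x) ^+ 2)%:E)%E.
  apply: eq_integral => x _.
  by rewrite /= ger0_norm ?normc_ge0// powR_mulrn ?normc_ge0// normc_sqr.
have two : (2 : R) != 0 by [].
split.
  move=> [mr mi fin].
  have I2 : integrableR mu (fun x => Re (f x) ^+ 2 + Im (f x) ^+ 2).
    apply/integrableP; split.
      by apply/measurable_EFinP; apply: measurable_funD; exact: measurable_funX.
    have := poweR_lty 2 fin; rewrite poweR_Lnorm// E.
    congr (_ < _)%E; apply: eq_integral => x _.
    by rewrite /= ger0_norm// addr_ge0// sqr_ge0.
  split; split=> //.
    refine (@integrableR_le _ _ _ mu _ _ _ I2 _); first exact: measurable_funX.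
    by move=> x; rewrite ger0_norm ?sqr_ge0// lerDl sqr_ge0.
  refine (@integrableR_le _ _ _ mu _ _ _ I2 _); first exact: measurable_funX.
  by move=> x; rewrite ger0_norm ?sqr_ge0// lerDr sqr_ge0.
move=> [[mr r2] [mi i2]]; split=> //.
rewrite /finite_norm (@lty_poweRy _ _ 2)// poweR_Lnorm// E.
have /integrableP[_] := integrableRD r2 i2.
congr (_ < _)%E; apply: eq_integral => x _.
by rewrite /= ger0_norm// addr_ge0// sqr_ge0.
Qed.

Lemma cLp1_integrable f : cLp 1%:E f ->
  integrableR mu (fun x => Re (f x)) /\ integrableR mu (fun x => Im (f x)).
Proof.
move=> [mr mi]; rewrite /finite_norm Lnorm1 => fin.
have mn : measurable_fun [set: R] (fun x => ComplexField.Normc.normc (f x)).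
  rewrite (_ : (fun _ => _) = (fun x => Num.sqrt (Re (f x) ^+ 2 + Im (f x) ^+ 2))).
    apply: measurableT_comp.
      by apply: continuous_measurable_fun; exact: sqrt_continuous.
    by apply: measurable_funD; exact: measurable_funX.
  by apply/funext => x; case: (f x).
have iN : integrableR mu (fun x => ComplexField.Normc.normc (f x)).
  by apply/integrableP; split=> //; exact/measurable_EFinP.
split.
  by refine (@integrableR_le _ _ _ mu _ _ mr iN _) => x; exact: Re_le_normc.
by refine (@integrableR_le _ _ _ mu _ _ mi iN _) => x; exact: Im_le_normc.
Qed.

Lemma cintegral_real u phi : cintegral (fun x => u x * (phi x)%:C) =
  dot (fun x => Re (u x)) phi +i* dot (fun x => Im (u x)) phi.
Proof.
by rewrite /cintegral; congr (_ +i* _); apply: eq_Rintegral => x _;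
  case: (u x) => a b /=; rewrite mulr0 ?subr0 ?add0r.
Qed.

Lemma weak_derivative_even u v : weak_derivative 2 u v <->
  (forall phi, csmooth phi ->
     dot (fun x => Re (u x)) (derive1 (derive1 phi)) = dot (fun x => Re (v x)) phi /\
     dot (fun x => Im (u x)) (derive1 (derive1 phi)) = dot (fun x => Im (v x)) phi).
Proof.
split=> H phi; last first.
  move=> /test_functionP cp; have [h1 h2] := H _ cp.
  by rewrite !cintegral_real expr2 mulrNN !mul1r /= h1 h2.
move=> cp; have := H _ ((test_functionP phi).2 cp).
by rewrite !cintegral_real expr2 mulrNN !mul1r => -[].
Qed.

Lemma weak_derivative_odd u v :
  (forall phi, csmooth phi ->
     dot (fun x => Re (u x)) (derive1 phi) = - dot (fun x => Re (v x)) phi /\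
     dot (fun x => Im (u x)) (derive1 phi) = - dot (fun x => Im (v x)) phi) ->
  weak_derivative 1 u v.
Proof.
move=> H phi /test_functionP cp; have [h1 h2] := H _ cp.
by rewrite !cintegral_real expr1 mulN1r /= h1 h2.
Qed.

Lemma ae_dot (p q g : R -> R) : {ae mu, forall x, p x = q x} ->
  measurable_fun [set: R] p -> measurable_fun [set: R] q ->
  measurable_fun [set: R] g -> dot p g = dot q g.
Proof.
move=> pq mp mq mg; rewrite /inner /Rintegral; congr fine.
apply: ae_eq_integral => //; try by apply/measurable_EFinP; exact: measurable_funM.
by apply: (@filterS _ _ (ae_filter_ringOfSetsType mu) _ _ _ pq) => x /= -> _.
Qed.

Lemma H2_solution_weak a h f u : cLp 2%:E f -> H2_solution a h f u ->
  weak_solution a h (fun x => Re (f x)) (fun x => Re (u x)) /\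
  weak_solution a h (fun x => Im (f x)) (fun x => Im (u x)).
Proof.
move=> /cLp2P[Lfr Lfi] [[/cLp2P[Lur Lui] _] [u2 [/cLp2P[L2r L2i] /weak_derivative_even wd eq]]].
have key (p p2 q : R -> R) : L2 p -> L2 p2 -> L2 q ->
    (forall phi, csmooth phi -> dot p (derive1 (derive1 phi)) = dot p2 phi) ->
    {ae mu, forall x, - p2 x - a * p (x - h) = q x} -> weak_solution a h q p.
  move=> Lp Lp2 Lq pd pq; split=> // phi cp.
  have L0 := csmooth_L2 cp.
  have L_2 := csmooth_L2 (csmooth_deriv (csmooth_deriv cp)).
  have Lh := csmooth_L2 (csmooth_shift h cp).
  have Lph := L2_shift (- h) Lp.
  have LNp2 := L2N Lp2; have Laph := L2Z a Lph.
  rewrite -(ae_dot pq); [|by case: (L2B LNp2 Laph)|by case: Lq|by case: L0].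
  rewrite (dotBl LNp2 Laph L0) (dotNl Lp2 L0) (dotZl a Lph L0).
  have -> : adj a h phi = fun x => - derive1 (derive1 phi) x - a * phi (x + h) by [].
  rewrite (dotBr (L2N L_2) (L2Z a Lh) Lp) (dotNr L_2 Lp) (dotZr a Lh Lp) pd//.
  congr (_ - a * _); rewrite -(dot_shift h Lph L0).
  by congr inner; apply/funext => x; rewrite addrK.
split; [apply: (key _ (fun x => Re (u2 x)))|apply: (key _ (fun x => Im (u2 x)))] => //.
- by move=> phi cp; case: (wd _ cp).
- apply: (@filterS _ _ (ae_filter_ringOfSetsType mu) _ _ _ eq) => x <-.
  by case: (u2 x) (u (x - h)) => [b c] [b' c'] /=; rewrite mul0r subr0.
- by move=> phi cp; case: (wd _ cp).
- apply: (@filterS _ _ (ae_filter_ringOfSetsType mu) _ _ _ eq) => x <-.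
  by case: (u2 x) (u (x - h)) => [b c] [b' c'] /=; rewrite mul0r addr0.
Qed.

(** Defining u'' by the equation makes the equation hold pointwise, and moving the shift across the
    inner product shows that it is the weak second derivative. Order one comes from
    [weak_first_derivative]. *)
Lemma weak_H2_solution a h f (p q : R -> R) : cLp 2%:E f ->
  weak_solution a h (fun x => Re (f x)) p ->
  weak_solution a h (fun x => Im (f x)) q ->
  H2_solution a h f (fun x => p x +i* q x).
Proof.
move=> /cLp2P[Lfr Lfi] Wp Wq.
pose u2 x := (- Re (f x) - a * p (x - h)) +i* (- Im (f x) - a * q (x - h)).
have key (g r : R -> R) : L2 g -> weak_solution a h g r ->
    [/\ L2 r, L2 (fun x => - g x - a * r (x - h)) &
     forall phi, csmooth phi ->
     dot r (derive1 (derive1 phi)) = dot (fun x => - g x - a * r (x - h)) phi].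
  move=> Lg [Lr rP]; have Lrh := L2_shift (- h) Lr.
  have LNg := L2N Lg; have Larh := L2Z a Lrh.
  split=> //; first exact: L2B.
  move=> phi cp; have L0 := csmooth_L2 cp.
  have L_2 := csmooth_L2 (csmooth_deriv (csmooth_deriv cp)).
  have Lh := csmooth_L2 (csmooth_shift h cp).
  have := rP _ cp.
  have -> : adj a h phi = fun x => - derive1 (derive1 phi) x - a * phi (x + h) by [].
  rewrite (dotBr (L2N L_2) (L2Z a Lh) Lr) (dotNr L_2 Lr) (dotZr a Lh Lr).
  rewrite (dotBl LNg Larh L0) (dotNl Lg L0) (dotZl a Lrh L0).
  have -> : dot r (fun x => phi (x + h)) = dot (fun x => r (x - h)) phi.
    rewrite -[RHS](dot_shift h Lrh L0).
    by congr inner; apply/funext => x; rewrite addrK.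
  by move=> <-; rewrite opprB opprK addrAC subrr add0r.
have [Lp Lp2 pd] := key _ _ Lfr Wp; have [Lq Lq2 qd] := key _ _ Lfi Wq.
have wd2 : weak_derivative 2 (fun x => p x +i* q x) u2.
  by apply/weak_derivative_even => phi cp; split; [exact: pd|exact: qd].
have Lu : cLp 2%:E (fun x => p x +i* q x) by apply/cLp2P.
have Lu2 : cLp 2%:E u2 by apply/cLp2P.
split.
  split=> // -[|[|[|//]]] _.
  - by exists (fun x => p x +i* q x) => // phi _; rewrite expr0 mul1r.
  - have [p1 [Lp1 p1P]] := weak_first_derivative Lp Lp2 pd.
    have [q1 [Lq1 q1P]] := weak_first_derivative Lq Lq2 qd.
    exists (fun x => p1 x +i* q1 x); first exact/cLp2P.
    by apply: weak_derivative_odd => phi cp; split; [exact: p1P|exact: q1P].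
  - by exists u2.
exists u2; split=> //.
apply: aeW => x; rewrite /u2; case: (f x) => b c /=.
by apply/eqP; rewrite eq_complex /= !mul0r subr0 addr0; apply/andP; split; apply/eqP; ring.
Qed.

(** Uniqueness is automatic for a > 0, so unique solvability amounts to the existence of weak
    solutions for the real and imaginary parts. *)
Lemma uniquely_solvableP a h f : 0 < a -> cLp 2%:E f ->
  uniquely_solvable_H2 a h f <->
  (exists p, weak_solution a h (fun x => Re (f x)) p) /\
  (exists q, weak_solution a h (fun x => Im (f x)) q).
Proof.
move=> a0 Lf; split.
  move=> [u [/(H2_solution_weak Lf)[up uq] _]].
  by split; [exists (fun x => Re (u x))|exists (fun x => Im (u x))].
move=> [[p Wp] [q Wq]]; exists (fun x => p x +i* q x).
split; first exact: weak_H2_solution.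
move=> w /(H2_solution_weak Lf)[wp wq].
have e1 := weak_solution_unique a0 Wp wp; have e2 := weak_solution_unique a0 Wq wq.
apply: (@filterS2 _ _ (ae_filter_ringOfSetsType mu) _ _ _ _ e1 e2) => x.
by case: (w x) => b c /= -> ->.
Qed.

(** Stated for any real frequency [t], so that the two signs of the orthogonality conditions are the
    cases t = w and t = - w. *)
Lemma L2dot_expi f (s t : R) : 0 < s ->
  integrableR mu (fun x => Re (f x)) -> integrableR mu (fun x => Im (f x)) ->
  L2dot f (fun x => expi (t * x) / s%:C) =
  ((\int[mu]_x (Re (f x) * cos (t * x)) + \int[mu]_x (Im (f x) * sin (t * x))) / s) +i*
  ((\int[mu]_x (Im (f x) * cos (t * x)) - \int[mu]_x (Re (f x) * sin (t * x))) / s).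
Proof.
move=> s0 ir ii.
have E x : f x * (expi (t * x) / s%:C)^* =
    (s^-1 * (Re (f x) * cos (t * x) + Im (f x) * sin (t * x))) +i*
    (s^-1 * (Im (f x) * cos (t * x) - Re (f x) * sin (t * x))).
  have -> : (s%:C)^-1 = (s^-1)%:C by rewrite fmorphV.
  case: (f x) => b c; rewrite /expi; apply/eqP; rewrite eq_complex /=.
  by apply/andP; split; apply/eqP; ring.
have sc (g k : R -> R) : integrableR mu g -> smooth k -> (forall x, `|k x| <= 1) ->
    integrableR mu (fun x => g x * k x).
  move=> ig sk k1; refine (@integrableR_le _ _ _ mu _ _ _ (integrable_norm ig) _).
    by apply: measurable_funM; [exact: (integrableR_meas ig)|exact: smooth_measurable].
  by move=> x /=; rewrite normrM ler_piMr.
have scos : smooth (fun x => cos (t * x)).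
  by have := @smooth_trig R 1 0 t; under [X in smooth X -> _]funext do
    rewrite mul0r addr0 mul1r.
have ssin : smooth (fun x => sin (t * x)).
  by have := @smooth_trig R 0 1 t; under [X in smooth X -> _]funext do
    rewrite mul0r add0r mul1r.
have cb x : `|cos (t * x)| <= 1 by exact: cos_max.
have sb x : `|sin (t * x)| <= 1 by exact: sin_max.
have i1 := sc _ _ ir scos cb; have i2 := sc _ _ ii ssin sb.
have i3 := sc _ _ ii scos cb; have i4 := sc _ _ ir ssin sb.
rewrite /L2dot /cintegral; congr (_ +i* _).
- rewrite [RHS]mulrC -RintegralD// -RintegralZl//; last exact: integrableRD.
  by apply: eq_Rintegral => x _; rewrite E.
- rewrite [RHS]mulrC -RintegralB// -RintegralZl//; last exact: integrableRB.
  by apply: eq_Rintegral => x _; rewrite E.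
Qed.

End ComplexValued.

Theorem theorem1 (R : realType) (a h : R) (f : R -> R[i])
    (a_gt0 : 0 < a) (h_neq0 : h != 0) (fL2 : cLp 2%:E f) :
  ((forall n : int, h != 2 * pi * n%:~R / Num.sqrt a) ->
     uniquely_solvable_H2 a h f)
  /\
  ((exists2 n : int, n != 0 & h = 2 * pi * n%:~R / Num.sqrt a) ->
   cLp 1%:E (fun x => x%:C * f x) ->
   (uniquely_solvable_H2 a h f <->
      L2dot f (fun x => expi (Num.sqrt a * x) / (Num.sqrt (2 * pi))%:C) = 0 /\
      L2dot f (fun x => expi (- (Num.sqrt a * x)) / (Num.sqrt (2 * pi))%:C)
        = 0)).
Proof.
have [Lr Li] := (cLp2P f).1 fL2.
split.
  move=> hn; apply/(uniquely_solvableP h a_gt0 fL2).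
  have [C HC] := apriori_bound a_gt0 hn.
  have ex (g : R -> R) : square_integrable lebesgue_measure g -> exists p, weak_solution a h g p.
    move=> Lg; apply: (@weak_solution_exists _ a h g (inner lebesgue_measure g g * C)) => //.
    move=> phi cp; apply: (le_trans (cauchy_schwarz Lg (csmooth_L2 cp))).
    by rewrite -mulrA ler_wpM2l ?dot_ge0// HC.
  by split; exact: ex.
move=> [n _ hE] /cLp1_integrable[xr xi].
have {}xr : integrableR lebesgue_measure (fun x => x * complex.Re (f x)).
  by move: xr; congr integrableR; apply/funext => x; case: (f x) => b c /=;
    rewrite mul0r subr0.
have {}xi : integrableR lebesgue_measure (fun x => x * complex.Im (f x)).
  by move: xi; congr integrableR; apply/funext => x; case: (f x) => b c /=;
    rewrite mul0r addr0.
have ir := integrable_of_moment Lr xr; have ii := integrable_of_moment Li xi.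
pose w := Num.sqrt a; pose s : R := Num.sqrt (2 * pi).
have w_gt0 : 0 < w by rewrite sqrtr_gt0.
have w0 : w != 0 by rewrite gt_eqF.
have w2 : w ^+ 2 = a by rewrite sqr_sqrtr// ltW.
have s0 : 0 < s by rewrite sqrtr_gt0 mulr_gt0// pi_gt0.
set A1 := L2dot _ _; set A2 := L2dot _ _.
have A1E : A1 = _ := L2dot_expi w s0 ir ii.
have A2E : A2 = L2dot f (fun x => expi (- w * x) / s%:C).
  by congr L2dot; apply/funext => x; rewrite mulNr.
rewrite (L2dot_expi (- w) s0 ir ii) in A2E.
have cosE (g : R -> R) : \int[lebesgue_measure]_x (g x * cos (- w * x)) =
    \int[lebesgue_measure]_x (g x * cos (w * x)).
  by apply: eq_Rintegral => x _; rewrite mulNr cosN.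
have sinE (g : R -> R) : square_integrable lebesgue_measure g -> integrableR lebesgue_measure g ->
    \int[lebesgue_measure]_x (g x * sin (- w * x)) =
    - \int[lebesgue_measure]_x (g x * sin (w * x)).
  move=> Lg ig; rewrite -[RHS]mulN1r -RintegralZl//.
    by apply: eq_Rintegral => x _; rewrite mulNr sinN mulrN mulN1r.
  refine (@integrableR_le _ _ _ lebesgue_measure _ _ _ (integrable_norm ig) _).
    apply: measurable_funM; first exact: (integrableR_meas ig).
    have := @smooth_trig R 0 1 w; under [X in smooth X -> _]funext do
      rewrite mul0r add0r mul1r.
    exact: smooth_measurable.
  by move=> x /=; rewrite normrM ler_piMr//; exact: sin_max.
rewrite !cosE !sinE// in A2E.
set rc := \int[lebesgue_measure]_x (complex.Re (f x) * cos (w * x)) in A1E A2E.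
set rs := \int[lebesgue_measure]_x (complex.Re (f x) * sin (w * x)) in A1E A2E.
set ic := \int[lebesgue_measure]_x (complex.Im (f x) * cos (w * x)) in A1E A2E.
set is_ := \int[lebesgue_measure]_x (complex.Im (f x) * sin (w * x)) in A1E A2E.
rewrite A1E A2E; split.
  move=> /(uniquely_solvableP h a_gt0 fL2)[[p Wp] [q Wq]].
  rewrite -w2 in Wp Wq.
  have o (g : R -> R) (u : R -> R) : square_integrable lebesgue_measure g ->
      integrableR lebesgue_measure g -> weak_solution (w ^+ 2) h g u ->
      \int[lebesgue_measure]_x (g x * cos (w * x)) = 0 /\
      \int[lebesgue_measure]_x (g x * sin (w * x)) = 0.
    move=> Lg ig Wu; split.
      rewrite -[RHS](resonant_orthogonality 1 0 w_gt0 hE Lg ig Wu).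
      by apply: eq_Rintegral => x _; rewrite mul0r addr0 mul1r.
    rewrite -[RHS](resonant_orthogonality 0 1 w_gt0 hE Lg ig Wu).
    by apply: eq_Rintegral => x _; rewrite mul0r add0r mul1r.
  have [rc0 rs0] := o _ _ Lr ir Wp; have [ic0 is0] := o _ _ Li ii Wq.
  by rewrite /rc /rs /ic /is_ rc0 rs0 ic0 is0 !(oppr0, addr0, mul0r).
move=> [[e1 e2] [e3 e4]].
have sn (x : R) : x / s = 0 -> x = 0.
  by move=> /eqP; rewrite mulf_eq0 invr_eq0 (gt_eqF s0) orbF => /eqP.
have {}e1 := sn _ e1; have {}e2 := sn _ e2.
have {}e3 := sn _ e3; have {}e4 := sn _ e4.
apply/(uniquely_solvableP h a_gt0 fL2).
have ex (g : R -> R) : square_integrable lebesgue_measure g ->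
    integrableR lebesgue_measure (fun x => x * g x) ->
    \int[lebesgue_measure]_x (g x * cos (w * x)) = 0 ->
    \int[lebesgue_measure]_x (g x * sin (w * x)) = 0 ->
    exists p, weak_solution a h g p.
  move=> Lg xg gc gs; have [C HC] := resonant_bound w0 Lg xg gc gs.
  apply: (@weak_solution_exists _ a h g `|C|) => // phi cp.
  have := HC phi _ cp erefl; rewrite w2 => le1; apply: (le_trans le1).
  apply: le_trans (ler_wpM2l (normr_ge0 C) (dot_adj_energy h a_gt0 cp)).
  by rewrite ler_wpM2r ?dot_ge0// ler_norm.
(* The two complex conditions read rc + is_ = 0, ic - rs = 0 and rc - is_ = 0, ic + rs = 0; their
   sums and differences separate the real and imaginary parts of f. *)
have [rc0 is0] : rc = 0 /\ is_ = 0 by split; lra.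
have [ic0 rs0] : ic = 0 /\ rs = 0 by split; lra.
by split; exact: ex.
Qed.
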